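(* Consider the Stochastic Block Model with a known fixed number $Q$ of blocks and edge values from a univariate exponential family, observed under random dyad sampling with parameter $\rho=\rho_n$, and assume that (A1)–(A4) hold (all defined in the context). Let $n\to\infty$ with $\rho\gg\log(n)/n$ (i.e. $n\rho_n/\log n\to\infty$). Then $$\frac{p(\mathbf y^{o};\theta)}{p(\mathbf y^{o};\theta^\star)}=\frac{\#\mathrm{Sym}(\theta)}{\#\mathrm{Sym}(\theta^\star)}\;\max_{\theta'\sim\theta}\frac{p(\mathbf y^{o},\mathbf z^\star;\theta')}{p(\mathbf y^{o},\mathbf z^\star;\theta^\star)}\,\bigl(1+o_P(1)\bigr)+o_P(1),$$ where both $o_P(1)$ terms are uniform over all $\theta\in\Theta$ (that is, they are of the form $\varepsilon_n(\theta)$ with $\sup_{\theta\in\Theta}|\varepsilon_n(\theta)|\to0$ in $\mathbb P_{\theta^\star}$-probability).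
   Context: **Model.** $Q\ge1$ is fixed and known; there are $n$ nodes. Let $\varphi(y,\pi)=b(y)\exp(\pi y-\psi(\pi))$, $\pi\in\mathcal A\subset\mathbb R$, be a regular one-dimensional exponential family in canonical form (densities with respect to a fixed dominating measure); on the interior $\mathring{\mathcal A}$, $\psi$ is smooth and convex, and $\psi'(\pi)$, $\psi''(\pi)>0$ are the mean and variance of $\varphi(\cdot,\pi)$. A parameter is $\theta=(\alpha,\pi)$ with $\alpha=(\alpha_1,\dots,\alpha_Q)$ a probability vector and $\pi=(\pi_{q\ell})$ a $Q\times Q$ matrix. Under $\theta$: $z_1,\dots,z_n$ are i.i.d. with $\mathbb P(z_i=q)=\alpha_q$; conditionally on $\mathbf z=(z_1,\dots,z_n)$, the variables $y_{ij}$ (ordered pairs $i\ne j$) are independent with $y_{ij}\sim\varphi(\cdot,\pi_{z_iz_j})$. Data are generated under a fixed true parameter $\theta^\star=(\alpha^\star,\pi^\star)$, with true memberships $\mathbf z^\star$. **Random dyad sampling.** The $r_{ij}$ ($i\ne j$) are i.i.d. Bernoulli($\rho$), independent of everything else; one observes $\mathbf r$ and $\mathbf y^{o}=\{y_{ij}:r_{ij}=1\}$. **Likelihoods.** $p(\mathbf y^o,\mathbf z;\theta)=\prod_i\alpha_{z_i}\prod_{i\neq j:\,r_{ij}=1}\varphi(y_{ij},\pi_{z_iz_j})$ and $p(\mathbf y^o;\theta)=\sum_{\mathbf z\in\{1,\dots,Q\}^n}p(\mathbf y^o,\mathbf z;\theta)$. **Assumptions.** (A1) There are a constant $c>0$ and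 a compact interval $C_\pi\subset\mathring{\mathcal A}$ with $\Theta\subset[c,1-c]^Q\times C_\pi^{Q\times Q}$, where $\Theta$ is the parameter space. (A2) $\theta^\star$ lies in the interior of $\Theta$. (A3) The map $\pi\mapsto\varphi(\cdot,\pi)$ is injective. (A4) The coordinates of the vector $\psi'(\pi^\star)\alpha^\star$ ($\psi'$ applied entrywise to the matrix $\pi^\star$) are pairwise distinct. **Equivalence and symmetry.** For a permutation $s$ of $\{1,\dots,Q\}$, $\alpha^s=(\alpha_{s(q)})_q$, $\pi^s=(\pi_{s(q)s(\ell)})_{q,\ell}$, $\theta^s=(\alpha^s,\pi^s)$. Write $\theta'\sim\theta$ if $\theta'=\theta^s$ for some $s$. $\mathrm{Sym}(\theta)=\{s:\theta^s=\theta\}$ and $\#\mathrm{Sym}(\theta)$ is its cardinality. *)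

(* Defs.v *)
From HB Require Import structures.
From mathcomp Require Import all_boot all_order all_algebra all_fingroup.
From mathcomp Require Import all_classical all_reals all_analysis.
Set Implicit Arguments.
Unset Strict Implicit.
Unset Printing Implicit Defensive.
Import Order.TTheory GRing.Theory Num.Theory.
Import numFieldNormedType.Exports.
Local Open Scope classical_set_scope.
Local Open Scope ring_scope.

Section ExponentialFamily.
Variable R : realType.
Implicit Types (b psi : R -> R) (A : set R).

Definition phi b psi (y x : R) : R := b y * expR (x * y - psi x).

(* [psi] is only meaningful on [A]; its values elsewhere are arbitrary, which
   is why convexity is only asked on the intervals contained in the interior.
   The two moment identities force the corresponding integrals to converge,
   because an undefined Lebesgue integral is infinite in \bar R. *)
Definition regular_exp_family (mu : {measure set (measurableTypeR R) -> \bar R})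
    b psi A : Prop :=
  [/\ measurable_fun [set: measurableTypeR R] (b : measurableTypeR R -> R),
      forall y, 0 <= b y,
      forall x, A x -> (\int[mu]_y (phi b psi y x)%:E = 1)%E,
      (forall k x, A° x -> derivable (derive1n k psi) x 1) /\
      (forall u v, `[u, v] `<=` A° -> convex_function `[u, v] psi) &
      forall x, A° x ->
        [/\ (\int[mu]_y (y * phi b psi y x)%:E = (derive1 psi x)%:E)%E,
            (\int[mu]_y ((y - derive1 psi x) ^+ 2 * phi b psi y x)%:E
              = (derive1n 2 psi x)%:E)%E
          & 0 < derive1n 2 psi x]].

End ExponentialFamily.

Notation param R Q := ('cV[R]_Q * 'M[R]_Q)%type.

Section ParamSpace.
Variables (R : realType) (Q : nat).
Implicit Types (t : param R Q) (A : set R) (Theta : set (param R Q)).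

Definition param_space A : set (param R Q) :=
  [set t : param R Q | [/\ forall q, 0 <= t.1 q ord0, \sum_q t.1 q ord0 = 1
             & forall q l, A (t.2 q l)]].

Definition bounded_params A Theta : Prop :=
  exists c : R, 0 < c /\ exists u v : R, [set` `[u, v]] `<=` A° /\
    forall t, Theta t ->
      (forall q, c <= t.1 q ord0 <= 1 - c) /\
      (forall q l, u <= t.2 q l <= v).

(* Proportions sum to 1, so [Theta] has empty interior in the ambient
   vector space: the interior is relative to the set of all parameters. *)
Definition rel_interior A Theta : set (param R Q) :=
  [set t : param R Q | Theta t /\ \forall t' \near within (param_space A) (nbhs t), Theta t'].

Definition injective_family (b psi : R -> R) A : Prop :=
  {in A &, injective (fun x y => phi b psi y x)}.

Definition distinct_mean_degrees (psi : R -> R) t : Prop :=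
  injective (fun q => (map_mx (derive1 psi) t.2 *m t.1) q ord0).

Definition relabel (s : 'S_Q) t : param R Q :=
  (\col_q t.1 (s q) ord0, \matrix_(q, l) t.2 (s q) (s l)).

Definition sym_perms t : {set 'S_Q} := [set s | relabel s t == t].

(* The list of all t' with t' ~ t; it may contain repetitions. *)
Definition equiv_params t : seq (param R Q) := [seq relabel s t | s : 'S_Q].

(* [t] itself belongs to the list, so the initial value of the fold does not
   alter the maximum. *)
Definition max_equiv (F : param R Q -> R) t : R :=
  \big[Num.max/F t]_(t' <- equiv_params t) F t'.

End ParamSpace.

Section Likelihoods.
Variables (R : realType) (Q n : nat).
Implicit Types (b psi : R -> R) (t : param R Q).
Implicit Types (z : {ffun 'I_n -> 'I_Q}) (r : rel 'I_n) (y : 'M[R]_n).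

Definition complete_lik b psi r y z t : R :=
  (\prod_i t.1 (z i) ord0) *
  \prod_(e : 'I_n * 'I_n | (e.1 != e.2) && r e.1 e.2)
     phi b psi (y e.1 e.2) (t.2 (z e.1) (z e.2)).

Definition observed_lik b psi r y t : R :=
  \sum_(z : {ffun 'I_n -> 'I_Q}) complete_lik b psi r y z t.

End Likelihoods.

Section Model.
Variables (R : realType) (Q n : nat).
Variables (d : measure_display) (T : measurableType d) (P : probability T R).

Definition dyads_in (y : T -> 'M[R]_n) (B : 'I_n -> 'I_n -> set R) : set T :=
  [set w | forall i j, i != j -> B i j (y w i j)].

Definition sampled_as (r : T -> rel 'I_n) (r0 : rel 'I_n) : set T :=
  [set w | forall i j, i != j -> r w i j = r0 i j].

(* Joint law of (z, y, r), given by its values on rectangles: [z] is i.i.d.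
   with law t.1; given [z = z0], the y_ij are independent with densities
   phi(., t.2 (z0 i) (z0 j)); the r_ij are i.i.d. Bernoulli(rho), independent of
   (z, y). Diagonal entries of [y] and [r] are never used. *)
Definition sbm_dyad_sample (mu : {measure set (measurableTypeR R) -> \bar R})
    (b psi : R -> R) (t : param R Q) (rho : R)
    (z : T -> {ffun 'I_n -> 'I_Q}) (y : T -> 'M[R]_n) (r : T -> rel 'I_n)
    : Prop :=
  [/\ [/\ forall z0, measurable (z @^-1` [set z0]),
          forall i j, i != j ->
            measurable_fun [set: T] (fun w => y w i j : measurableTypeR R)
        & forall i j, i != j -> measurable_fun [set: T] (fun w => r w i j)],
      forall z0, P (z @^-1` [set z0]) = (\prod_i t.1 (z0 i) ord0)%:E,
      forall z0 (B : 'I_n -> 'I_n -> set (measurableTypeR R)),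
        (forall i j, measurable (B i j)) ->
        P (z @^-1` [set z0] `&` dyads_in y B) =
        (P (z @^-1` [set z0]) *
         \prod_(e : 'I_n * 'I_n | e.1 != e.2)
           \int[mu]_(x in B e.1 e.2)
              (phi b psi x (t.2 (z0 e.1) (z0 e.2)))%:E)%E
    & forall z0 (B : 'I_n -> 'I_n -> set (measurableTypeR R)) (r0 : rel 'I_n),
        (forall i j, measurable (B i j)) ->
        P (z @^-1` [set z0] `&` dyads_in y B `&` sampled_as r r0) =
        (P (z @^-1` [set z0] `&` dyads_in y B) *
         (\prod_(e : 'I_n * 'I_n | e.1 != e.2)
           bernoulli_pmf rho (r0 e.1 e.2))%:E)%E].

End Model.

(* [Theta] is an arbitrary set, so the supremum need not be measurable:
   convergence in probability is taken for the outer measure [mu_ext (P n)],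
   which is P n itself on measurable events. *)
Definition uniform_oP (R : realType) (d : nat -> measure_display)
    (T : forall n, measurableType (d n)) (P : forall n, probability (T n) R)
    (I : Type) (Theta : set I) (e : forall n, T n -> I -> R) : Prop :=
  forall eps : R, 0 < eps ->
    (fun n => mu_ext (P n)
       [set w | (eps%:E < ereal_sup [set `|e n w t|%:E | t in Theta])%E])
    @ \oo --> 0%E.

(* Main.v *)
Require Import Defs.
From HB Require Import structures.
From mathcomp Require Import all_boot all_order all_algebra all_fingroup.
From mathcomp Require Import all_classical all_reals all_analysis.
From mathcomp Require Import measurable_realfun ring lra.
Set Implicit Arguments.
Unset Strict Implicit.
Unset Printing Implicit Defensive.
Import Order.TTheory GRing.Theory Num.Theory.
Import numFieldNormedType.Exports.
Local Open Scope classical_set_scope.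
Local Open Scope ring_scope.

(** Write rr z t for the square root of p(y, z; t) / p(y, z0; ts), where ts is
    the true parameter and z0 the true label vector.  The density of the base
    measure cancels, so rr is a ratio of amplitudes, and given z0 its mean is
    explicit: a product of Bhattacharyya coefficients, one factor
    1 - rho + rho * affinity per dyad.

    Two families of terms are negligible, uniformly in t.  First, the z that do
    not induce the partition of z0: such a z misclassifies m > 0 nodes, hence
    at least of order n * m dyads carry a parameter that differs from the true
    one, because the rows of the true connection matrix are distinct
    (far_dyads_misclassified), and the mean of rr is at most
    exp(- k * n * rho * m); the sum over z and z0 of these bounds factorizes
    over nodes (sum_mean_amplitude_misaligned).  Second, z = z0 when t is at a
    distance from ts (sum_mean_amplitude_far_param).  Both means are
    exponentially small in n * rho, which beats every power of n because
    n * rho / ln n tends to infinity.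

    Uniformity in t then costs only a union over a net of polynomial size.
    Passing from t to the net needs no control of the data: the log-likelihood
    is linear in the data and in the connection parameters up to the cumulant
    function, so each parameter can be rounded in the favourable direction
    (amplitude_le_grid).  Markov's inequality concludes (net_remainder_event).

    What remains of p(y; t) is the sum over the permutations s of
    p(y, z0; relabel s t).  The true parameter has no symmetry, so at most one
    relabelling of t is close to it, the other terms are negligible, and t has
    no symmetry either when there is one: the sum agrees with #Sym(t) times
    the maximum up to a negligible additive term (sum_relabel_approx).  The
    same statement at t = ts gives the denominator. *)

(** * Cumulant function *)

Section Cumulant.
Variables (R : realType) (psi : R -> R) (u v : R).
Hypothesis smooth : forall k x, u <= x <= v -> derivable (derive1n k psi) x 1.
Hypothesis curved : forall x, u <= x <= v -> 0 < derive1n 2 psi x.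

Let sub_in x y z : u <= x <= v -> u <= y <= v -> x <= z <= y -> u <= z <= v.
Proof. by move=> /andP[? ?] /andP[? ?] /andP[? ?]; apply/andP; split; lra. Qed.

Let is_derive_psi k x : u <= x <= v ->
  is_derive x 1 (derive1n k psi) (derive1n k.+1 psi x).
Proof.
by move=> xuv; apply: DeriveDef; [exact: smooth|rewrite derive1nS derive1E].
Qed.

Let continuous_psi k x y : u <= x <= v -> u <= y <= v ->
  {within `[x, y], continuous (derive1n k psi)}.
Proof.
move=> xuv yuv; apply: derivable_within_continuous => c.
by rewrite in_itv/= => cxy; apply: smooth; exact: sub_in cxy.
Qed.

Let MVT_psi k x y : u <= x <= v -> u <= y <= v -> x <= y ->
  exists2 c, x <= c <= y &
    derive1n k psi y - derive1n k psi x = derive1n k.+1 psi c * (y - x).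
Proof.
move=> xuv yuv xy.
have [| |c] := @MVT_segment _ (derive1n k psi) (derive1n k.+1 psi) _ _ xy;
  last 2 first.
- exact: continuous_psi.
- by rewrite in_itv/= => cxy E; exists c.
move=> c; rewrite in_itv/= => /andP[/ltW xc /ltW cy].
by apply: is_derive_psi; apply: (sub_in xuv yuv); rewrite xc.
Qed.

(** The mean is bounded on the compact interval. *)
Lemma cumulant_lipschitz : exists2 L, 0 <= L &
  forall x y, u <= x <= v -> u <= y <= v -> `|psi x - psi y| <= L * `|x - y|.
Proof.
have [uv|vu] := leP u v; last first.
  by exists 0 => // x y /andP[ux xv]; move: (lt_le_trans vu ux); rewrite ltNge xv.
have uuv : u <= u <= v by rewrite lexx.
have vuv : u <= v <= v by rewrite lexx uv.
have [cM _ HM] := EVT_max uv (@continuous_psi 1 _ _ uuv vuv).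
have [cm _ Hm] := EVT_min uv (@continuous_psi 1 _ _ uuv vuv).
exists (`|derive1n 1 psi cM| + `|derive1n 1 psi cm|); first by rewrite addr_ge0.
suff H x y : u <= x <= v -> u <= y <= v -> x <= y ->
    `|psi y - psi x| <= (`|derive1n 1 psi cM| + `|derive1n 1 psi cm|) * `|y - x|.
  move=> x y xuv yuv; have [xy|/ltW yx] := leP x y; last exact: H.
  by rewrite distrC (distrC x); exact: H.
move=> xuv yuv xy; have [c cxy E] := MVT_psi 0 xuv yuv xy.
rewrite [psi y - psi x](E : _ = derive1n 1 psi c * (y - x)) normrM ler_wpM2r//.
have cuv := sub_in xuv yuv cxy.
have := HM c; have := Hm c; rewrite in_itv/= cuv => /(_ isT) h1 /(_ isT) h2.
have bound (p pm pM : R) : pm <= p -> p <= pM -> `|p| <= `|pM| + `|pm|.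
  move=> pmp ppM; rewrite ler_norml.
  have := ler_norm pM; have := ler_norm (- pm); rewrite normrN.
  have := normr_ge0 pM; have := normr_ge0 pm.
  by move=> *; apply/andP; split; lra.
exact: bound.
Qed.

(** Strong convexity: the variance is bounded below on the compact interval,
    so subtracting the corresponding parabola leaves a convex function. *)
Lemma cumulant_midpoint_gap : exists2 k, 0 < k &
  forall x a, u <= x <= v -> u <= a <= v ->
    k * (x - a) ^+ 2 <= (psi x + psi a) / 2 - psi ((x + a) / 2).
Proof.
have [uv|vu] := leP u v; last first.
  by exists 1 => // x y /andP[ux xv]; move: (lt_le_trans vu ux); rewrite ltNge xv.
have uuv : u <= u <= v by rewrite lexx.
have vuv : u <= v <= v by rewrite lexx uv.
have [cm cmuv Hm] := EVT_min uv (@continuous_psi 2 _ _ uuv vuv).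
set k := derive1n 2 psi cm in Hm.
have k0 : 0 < k by apply: curved; move: cmuv; rewrite in_itv.
exists (k / 8); first by rewrite divr_gt0.
suff H x a : u <= x <= v -> u <= a <= v -> x <= a ->
    k / 8 * (x - a) ^+ 2 <= (psi x + psi a) / 2 - psi ((x + a) / 2).
  move=> x a xuv auv; have [xa|/ltW ax] := leP x a; first exact: H.
  by rewrite -sqrrN opprB (addrC (psi x)) (addrC x); exact: H.
move=> xuv auv xa; set m := (x + a) / 2.
have xm : x <= m by rewrite /m; lra.
have ma : m <= a by rewrite /m; lra.
have muv : u <= m <= v by apply: (sub_in xuv auv); rewrite xm.
pose g := psi \- (fun s => k / 2 * s ^+ 2).
have dg s : u <= s <= v -> is_derive s 1 g (derive1n 1 psi s - k * s).
  move=> suv; have dpsi := is_derive_psi 0 suv.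
  apply: is_derive_eq; rewrite /GRing.scale/=; lra.
have MVT_g s t : u <= s <= v -> u <= t <= v -> s <= t ->
    exists2 c, s <= c <= t & g t - g s = (derive1n 1 psi c - k * c) * (t - s).
  move=> suv tuv st.
  have [| |c] := @MVT_segment _ g (fun c => derive1n 1 psi c - k * c) _ _ st.
  - move=> c; rewrite in_itv/= => /andP[/ltW xc /ltW cy].
    by apply: dg; apply: (sub_in suv tuv); rewrite xc.
  - apply: derivable_within_continuous => c; rewrite in_itv/= => cst.
    by have [] := dg c (sub_in suv tuv cst).
  - by rewrite in_itv/= => cst E; exists c.
have [c1 /andP[xc1 c1m] E1] := MVT_g _ _ xuv muv xm.
have [c2 /andP[mc2 c2a] E2] := MVT_g _ _ muv auv ma.
have c1uv : u <= c1 <= v by apply: (sub_in xuv muv); rewrite xc1.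
have c2uv : u <= c2 <= v by apply: (sub_in muv auv); rewrite mc2.
have c12 := le_trans c1m mc2.
have [c3 c3in E3] := MVT_psi 1 c1uv c2uv c12.
have kc3 : k <= derive1n 2 psi c3.
  by apply: Hm; rewrite in_itv/=; exact: sub_in c3in.
have D : 0 <= (derive1n 1 psi c2 - k * c2) - (derive1n 1 psi c1 - k * c1).
  have alg (p1 p2 q : R) : p2 - p1 = q * (c2 - c1) -> k <= q ->
      0 <= (p2 - k * c2) - (p1 - k * c1).
    move=> E kq; have -> : (p2 - k * c2) - (p1 - k * c1) = (q - k) * (c2 - c1).
      by rewrite mulrBl -E; ring.
    by rewrite mulr_ge0// subr_ge0.
  exact: alg E3 kc3.
have F : 0 <= (g a - g m) - (g m - g x).
  have -> : (g a - g m) - (g m - g x) =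
      ((derive1n 1 psi c2 - k * c2) - (derive1n 1 psi c1 - k * c1)) * ((a - x) / 2).
    by rewrite E1 E2 /m; lra.
  by rewrite mulr_ge0// divr_ge0// subr_ge0.
move: F; rewrite /g/= -/m.
have -> : psi x + psi a = 2 * ((psi x + psi a) / 2) by lra.
have : (x - a) ^+ 2 = 2 * (x ^+ 2 + a ^+ 2 - 2 * m ^+ 2) by rewrite /m; lra.
by move=> -> ?; lra.
Qed.

End Cumulant.

(** * Expectations of products over dyads *)

Section Transfer.
Local Open Scope ereal_scope.
Context (R : realType) (dY : measure_display) (Y : measurableType dY).
Variables (g : Y -> \bar R) (g0 : forall y, 0 <= g y)
  (mg : measurable_fun [set: Y] g).
Import HBNNSimple.

Let h := nnsfun_approx measurableT mg.

(** Approximation of g by simple functions, organized so that the right-hand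
    side depends on m, D, X and f only through the weighted masses of the
    preimages by X. *)
Lemma integral_comp_weight_limn (dT : measure_display) (T : measurableType dT)
    (m : {measure set T -> \bar R}) (D : set T) (mD : measurable D)
    (X : T -> Y) (mX : measurable_fun D X) (f : T -> \bar R)
    (f0 : forall x, 0 <= f x) (mf : measurable_fun D f) :
  \int[m]_(x in D) (g (X x) * f x) =
  limn (fun n => \sum_(y \in range (h n))
    (y%:E * \int[m]_(x in D) ((\1_(h n @^-1` [set y]) (X x))%:E * f x)))%E.
Proof.
have mB n r : measurable_fun D (fun x => (\1_(h n @^-1` [set r]) (X x))%:E : \bar R).
  apply/measurable_EFinP; apply: measurableT_comp mX.
  by apply: measurable_indic; exact: measurable_funPTI.
have eqF n : \int[m]_(x in D) ((h n (X x))%:E * f x) = (\sum_(y \in range (h n))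
    (y%:E * \int[m]_(x in D) ((\1_(h n @^-1` [set y]) (X x))%:E * f x)))%E.
  have pos r x : range (h n) r -> 0 <= r%:E.
    by move=> [t _ <-]; rewrite lee_fin.
  transitivity (\int[m]_(x in D) (\sum_(y \in range (h n))
      (Num.max y 0)%R%:E * ((\1_(h n @^-1` [set y]) (X x))%:E * f x))).
    apply: eq_integral => x xD; rewrite {1}fimfunE -fsumEFin // ge0_mule_fsuml; last first.
      by move=> y; exact: nnfun_muleindic_ge0.
    apply: eq_fsbigr => y /[!inE] -[t _ <-].
    by rewrite EFinM -muleA (max_idPl _).
  rewrite ge0_integral_fsum//; last 2 first.
  - by move=> y; apply: measurable_funeM; apply: emeasurable_funM.
  - move=> y x Dx; rewrite mule_ge0// ?lee_fin ?le_max ?lexx ?orbT//.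
    by rewrite mule_ge0// lee_fin.
  apply: eq_fsbigr => y /[!inE] -[t _ <-].
  rewrite ge0_integralZl//.
  - by rewrite (max_idPl _).
  - exact: emeasurable_funM.
  - by move=> x Dx; rewrite mule_ge0// lee_fin.
  - by rewrite lee_fin le_max lexx orbT.
transitivity (limn (fun n => \int[m]_(x in D) ((h n (X x))%:E * f x))); last first.
  by congr (limn _); apply/funext => n; exact: eqF.
rewrite -monotone_convergence//.
- apply: eq_integral => x xD; apply/esym/cvg_lim => //.
  have h1 : (h n (X x))%:E @[n --> \oo] --> g (X x) by exact: cvg_nnsfun_approx.
  have := f0 x; case fx : (f x) => [r| |//] r0.
    by apply: cvgeZr => //.
  have := g0 (X x); rewrite le_eqVlt => /predU1P[gx|gx].
    rewrite -gx mul0e (_ : (fun n => _) = cst 0); first exact: cvg_cst.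
    apply/funext => n; suff -> : h n (X x) = 0%R by rewrite mul0e.
    apply/eqP; rewrite eq_le; apply/andP; split; last by [].
    rewrite -lee_fin [leRHS]gx /h nnsfun_approxE.
    exact: le_approx.
  rewrite gt0_muley//; apply: cvg_near_cst.
  have : \forall n \near \oo, 0 < (h n (X x))%:E.
    exact: (h1 _ (open_ereal_gt' gx)).
  by apply: filterS => n hn; rewrite gt0_muley.
- move=> n; apply: emeasurable_funM => //.
  by apply/measurable_EFinP; apply: measurableT_comp.
- by move=> n x Dx; rewrite mule_ge0// lee_fin.
- by move=> x Dx a b ab; rewrite lee_wpmul2r// lee_fin; exact/lefP/nd_nnsfun_approx.
Unshelve. all: by end_near. Qed.

End Transfer.

Section CompTransfer.
Import HBNNSimple.

(** Two push-forwards of measures with densities that agree on sets agree on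
    functions.  As the base measure is arbitrary, this takes the place of
    Radon-Nikodym derivatives and of the uniqueness of product measures. *)
Lemma ge0_integral_comp_transfer (R : realType)
    (dY : measure_display) (Y : measurableType dY)
    (d1 : measure_display) (T1 : measurableType d1)
    (d2 : measure_display) (T2 : measurableType d2)
    (m1 : {measure set T1 -> \bar R}) (m2 : {measure set T2 -> \bar R})
    (D1 : set T1) (D2 : set T2) (X1 : T1 -> Y) (X2 : T2 -> Y)
    (f1 : T1 -> \bar R) (f2 : T2 -> \bar R) (g : Y -> \bar R) :
  measurable D1 -> measurable D2 ->
  measurable_fun D1 X1 -> measurable_fun D2 X2 ->
  measurable_fun D1 f1 -> measurable_fun D2 f2 ->
  (forall x, 0 <= f1 x)%E -> (forall x, 0 <= f2 x)%E ->
  measurable_fun [set: Y] g -> (forall y, 0 <= g y)%E ->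
  (forall B, measurable B ->
    \int[m1]_(x in D1) ((\1_B (X1 x))%:E * f1 x) =
    \int[m2]_(x in D2) ((\1_B (X2 x))%:E * f2 x))%E ->
  (\int[m1]_(x in D1) (g (X1 x) * f1 x) =
   \int[m2]_(x in D2) (g (X2 x) * f2 x))%E.
Proof.
move=> mD1 mD2 mX1 mX2 mf1 mf2 f10 f20 mg g0 H.
rewrite !(integral_comp_weight_limn g0 mg)//.
congr (limn _); apply/funext => n; apply: eq_fsbigr => y _.
by rewrite H//; exact: measurable_funPTI.
Qed.

End CompTransfer.

(** From the law of independent coordinates on rectangles to the expectation
    of a product: indicators are replaced by functions one coordinate at a
    time. *)
Lemma ge0_integral_prod_rectangles (R : realType)
    (dY : measure_display) (Y : measurableType dY)
    (dT : measure_display) (T : measurableType dT)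
    (m : {measure set T -> \bar R}) (mu : {measure set Y -> \bar R})
    (D : set T) (I : finType) (E : pred I) (X : I -> T -> Y)
    (f : I -> Y -> R) (K : R) :
  measurable D -> (forall i, E i -> measurable_fun [set: T] (X i)) ->
  (forall i, measurable_fun [set: Y] (f i)) -> (forall i y, 0 <= f i y) ->
  0 <= K ->
  (forall B : I -> set Y, (forall i, measurable (B i)) ->
    m (D `&` [set w | forall i, E i -> B i (X i w)]) =
    K%:E * \prod_(i | E i) \int[mu]_(y in B i) (f i y)%:E)%E ->
  forall g : I -> Y -> R,
  (forall i, measurable_fun [set: Y] (g i)) -> (forall i y, 0 <= g i y) ->
  (\int[m]_(w in D) (\prod_(i | E i) g i (X i w))%:E =
   K%:E * \prod_(i | E i) \int[mu]_y (g i y * f i y)%:E)%E.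
Proof.
move=> mD mX mf f0 K0 H.
have mgX g i : (forall i, measurable_fun [set: Y] (g i : Y -> R)) -> E i ->
    measurable_fun D (fun w => g i (X i w)).
  by move=> mg Ei; apply: measurable_funTS; exact: measurableT_comp (mX i Ei).
have H0 g (B : I -> set Y) : (forall i, measurable (B i)) ->
    (forall i, E i -> g i = \1_(B i) :> (Y -> R)) ->
    (\int[m]_(w in D) (\prod_(i | E i) g i (X i w))%:E =
     K%:E * \prod_(i | E i) \int[mu]_y (g i y * f i y)%:E)%E.
  move=> mB gB; transitivity
    (m (D `&` [set w | forall i, E i -> B i (X i w)])); last first.
    rewrite H//; congr (_ * _)%E; apply: eq_bigr => i Ei.
    rewrite integral_mkcond; apply: eq_integral => y _.
    rewrite gB// /patch indicE mulrC; case: ifPn => yB; rewrite ?mulr1 ?mulr0//.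
  set S := [set w | _].
  have mS : measurable S.
    have -> : S = \bigcap_(i in [set i | E i]) (X i @^-1` B i).
      by apply/seteqP; split => w.
    apply: fin_bigcap_measurable => // i Ei.
    by rewrite -[X in measurable X]setTI; exact: mX.
  rewrite setIC -integral_indic//; apply: eq_integral => w _; congr EFin.
  rewrite indicE; have [wS|wS] := boolP (w \in S).
    apply: big1 => i Ei; rewrite gB// indicE mem_set//.
    by move: wS; rewrite inE; apply.
  have [i Ei Bi] : exists2 i, E i & ~ B i (X i w).
    apply: contrapT => nex; move: wS; rewrite notin_setE; apply => i Ei.
    by apply: contrapT => nB; apply: nex; exists i.
  by rewrite (bigD1 i)//= gB// indicE memNset// mul0r.
(* s lists the coordinates where g is already arbitrary. *)
suff H1 s : uniq s -> forall g : I -> Y -> R,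
    (forall i, measurable_fun [set: Y] (g i)) -> (forall i y, 0 <= g i y) ->
    (forall i, i \notin s -> exists2 B, measurable B & g i = \1_B :> (Y -> R)) ->
    (\int[m]_(w in D) (\prod_(i | E i) g i (X i w))%:E =
     K%:E * \prod_(i | E i) \int[mu]_y (g i y * f i y)%:E)%E.
  move=> g mg g0; apply: (H1 (enum I)) => //; first exact: enum_uniq.
  by move=> i; rewrite mem_enum.
elim: s => [_ g mg g0 gB|i0 s IH].
  have gB' i : {B | measurable B & g i = \1_B :> (Y -> R)}.
    by apply: cid2; exact: gB.
  apply: (H0 g (fun i => s2val (gB' i))) => i; first exact: s2valP (gB' i).
  by move=> _; exact: s2valP' (gB' i).
move=> /= /andP[i0s us] g mg g0 gB.
have [Ei0|nEi0] := boolP (E i0); last first.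
  pose g' i := if i == i0 then \1_[set: Y] : Y -> R else g i.
  have g'E i : E i -> g' i = g i.
    by rewrite /g'; case: eqP => // ->; rewrite (negPf nEi0).
  transitivity (\int[m]_(w in D) (\prod_(i | E i) g' i (X i w))%:E)%E.
    by apply: eq_integral => w _; congr EFin; apply: eq_bigr => i /g'E ->.
  rewrite IH//.
  - by congr (_ * _)%E; apply: eq_bigr => i /g'E ->.
  - by move=> i; rewrite /g'; case: eqP => // _; exact: measurable_indic.
  - by move=> i y; rewrite /g'; case: eqP.
  - move=> i ins; rewrite /g'; case: eqP => [_|/eqP ii0].
      by exists setT.
    by apply: gB; rewrite inE negb_or ii0.
pose rest w := \prod_(i | E i && (i != i0)) g i (X i w).
pose c := (K%:E * \prod_(i | E i && (i != i0)) \int[mu]_y (g i y * f i y)%:E)%E.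
have c0 : (0 <= c)%E.
  rewrite mule_ge0 ?lee_fin// prode_ge0// => i _.
  by apply: integral_ge0 => y _; rewrite lee_fin mulr_ge0.
transitivity (\int[m]_(w in D) ((g i0 (X i0 w))%:E * (rest w)%:E))%E.
  by apply: eq_integral => w _; rewrite (bigD1 i0)//= EFinM.
transitivity (\int[mu]_y ((g i0 y)%:E * (c * (f i0 y)%:E)))%E; last first.
  under eq_integral do rewrite muleCA.
  rewrite ge0_integralZl//; last 2 first.
  - by apply: emeasurable_funM; apply/measurable_EFinP.
  - by move=> y _; rewrite -EFinM lee_fin mulr_ge0.
  by rewrite (bigD1 i0)//= /c -muleA; congr (_ * _)%E; rewrite muleC.
apply: (@ge0_integral_comp_transfer _ _ _ _ _ _ _ _ _ _ _ (X i0) idfun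
  (EFin \o rest) (fun y => c * (f i0 y)%:E)%E (EFin \o g i0)) => //.
- by apply: measurable_funTS; exact: mX.
- exact: measurable_id.
- apply/measurable_EFinP; rewrite /rest.
  under eq_fun do rewrite -big_filter.
  by apply: measurable_prod => i; rewrite mem_filter => /andP[/andP[Ei _] _]; exact: mgX.
- by apply: measurable_funeM; exact/measurable_EFinP.
- by move=> w; rewrite lee_fin prodr_ge0.
- by move=> y; rewrite mule_ge0// lee_fin.
- exact/measurable_EFinP.
- by move=> y; rewrite lee_fin.
move=> B mB.
pose g' i := if i == i0 then \1_B : Y -> R else g i.
have g'E i : i != i0 -> g' i = g i by rewrite /g' => /negPf ->.
have g'0 : g' i0 = \1_B by rewrite /g' eqxx.
transitivity (\int[m]_(w in D) (\prod_(i | E i) g' i (X i w))%:E)%E.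
  apply: eq_integral => w _; rewrite (bigD1 i0)//= EFinM g'0.
  by congr (_ * _%:E)%E; apply: eq_bigr => i /andP[_ /g'E ->].
rewrite IH//.
- rewrite (bigD1 i0)//= g'0.
  under [RHS]eq_integral do rewrite muleCA.
  rewrite ge0_integralZl//; last 2 first.
  - by apply: emeasurable_funM; apply/measurable_EFinP => //; exact: measurable_indic.
  - by move=> y _; rewrite -EFinM lee_fin mulr_ge0.
  rewrite /c -muleA; congr (_ * _)%E; rewrite muleC; congr (_ * _)%E.
  by apply: eq_bigr => i /andP[_ /g'E ->].
- by move=> i; rewrite /g'; case: eqP => // _; exact: measurable_indic.
- by move=> i y; rewrite /g'; case: eqP.
- move=> i ins; rewrite /g'; case: eqP => [_|/eqP ii0].
    by exists B.
  by apply: gB; rewrite inE negb_or ii0.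
Qed.

Lemma sampled_as_measurable (n : nat) (d : measure_display)
    (T : measurableType d) (r : T -> rel 'I_n) (r0 : rel 'I_n) :
  (forall i j, i != j -> measurable_fun [set: T] (fun w => r w i j)) ->
  measurable (sampled_as r r0).
Proof.
move=> mr.
have -> : sampled_as r r0 = \bigcap_(e in [set e : 'I_n * 'I_n | e.1 != e.2])
    [set w | r w e.1 e.2 = r0 e.1 e.2].
  apply/seteqP; split => w; first by move=> rw [i j] /=; exact: rw.
  by move=> rw i j ij; exact: (rw (i, j)).
apply: fin_bigcap_measurable => // -[i j] /= ij.
rewrite -[X in measurable X]setTI.
exact: (mr i j ij measurableT [set r0 i j]).
Qed.

(** The law of the sample is known on each sampling pattern; the product is
    expanded over the patterns, integrated term by term, and folded back into
    a product of sums over the two values of each indicator. *)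
Lemma sbm_integral_dyads (R : realType) (Q n : nat) (d : measure_display)
    (T : measurableType d) (P : probability T R)
    (mu : {measure set (measurableTypeR R) -> \bar R}) (b psi : R -> R)
    (t : param R Q) (rho : R) (z : T -> {ffun 'I_n -> 'I_Q})
    (y : T -> 'M[R]_n) (r : T -> rel 'I_n) (z0 : {ffun 'I_n -> 'I_Q})
    (g : 'I_n * 'I_n -> bool -> R -> R) (G : 'I_n * 'I_n -> bool -> R) :
  sbm_dyad_sample P mu b psi t rho z y r ->
  measurable_fun [set: measurableTypeR R] (b : measurableTypeR R -> R) ->
  (forall u, 0 <= b u) -> (forall q, 0 <= t.1 q ord0) -> 0 <= rho <= 1 ->
  (forall e c, measurable_fun [set: measurableTypeR R]
                 (g e c : measurableTypeR R -> R)) ->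
  (forall e c u, 0 <= g e c u) ->
  (forall e c, e.1 != e.2 ->
    \int[mu]_u (g e c u * phi b psi u (t.2 (z0 e.1) (z0 e.2)))%:E
      = (G e c)%:E)%E ->
  (\int[P]_(w in z @^-1` [set z0])
     (\prod_(e : 'I_n * 'I_n | e.1 != e.2)
        g e (r w e.1 e.2) (y w e.1 e.2))%:E =
   ((\prod_i t.1 (z0 i) ord0) * \prod_(e : 'I_n * 'I_n | e.1 != e.2)
      \sum_c bernoulli_pmf rho c * G e c)%:E)%E.
Proof.
move=> [[mz my mr] Pz Py Pr] mb b0 t0 rho01 mg g0 gG.
set E := fun e : 'I_n * 'I_n => e.1 != e.2.
set FF := pffun_on false E predT.
have mD f : measurable (z @^-1` [set z0] `&` sampled_as r (fun i j => f (i, j))).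
  by apply: measurableI => //; exact: sampled_as_measurable.
have mphi x : measurable_fun [set: measurableTypeR R]
    ((fun u => phi b psi u x) : measurableTypeR R -> R).
  apply: measurable_funM => //; apply: measurableT_comp => //.
  by apply: measurable_funB => //; exact: measurable_funM.
transitivity (\int[P]_(w in z @^-1` [set z0]) \sum_(f in FF)
    ((\1_(sampled_as r (fun i j => f (i, j))) w)%:E *
     (\prod_(e | E e) g e (f e) (y w e.1 e.2))%:E))%E.
  apply: eq_integral => w _.
  transitivity (\prod_(e | E e) \sum_(c | predT c)
      ((c == r w e.1 e.2)%:R * g e c (y w e.1 e.2)))%:E.
    congr EFin; apply: eq_bigr => e _.
    rewrite (bigD1 (r w e.1 e.2))//= eqxx mul1r big1 ?addr0// => c /negPf ->.
    by rewrite mul0r.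
  rewrite (big_distr_big false)/= -sumEFin; apply: eq_bigr => f _.
  rewrite -EFinM big_split/=; congr (_ * _)%:E.
  rewrite indicE; have [ws|ws] := boolP (w \in _).
    apply: big1 => -[i j] /= ij; move: ws; rewrite inE => /(_ i j ij) <-.
    by rewrite eqxx.
  have [[i j] ij fr] : exists2 e, E e & f e != r w e.1 e.2.
    apply: contrapT => nex; move: ws; rewrite notin_setE; apply => i j ij.
    by apply/eqP; rewrite eq_sym; apply/negPn/negP => fr; apply: nex; exists (i, j).
  by rewrite (bigD1 (i, j))//= (negPf fr) mul0r.
have mprod f : measurable_fun [set: T]
    (fun w => \prod_(e | E e) g e (f e) (y w e.1 e.2)).
  under eq_fun do rewrite -big_filter.
  apply: measurable_prod => e; rewrite mem_filter => /andP[Ee _].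
  by apply: (measurableT_comp (mg e (f e))); exact: my.
have prod_ge0 f w : 0 <= \prod_(e | E e) g e (f e) (y w e.1 e.2).
  by apply: prodr_ge0.
under eq_integral do rewrite -big_enum.
rewrite ge0_integral_sum//; last 2 first.
- move=> f; apply: measurable_funTS; apply: emeasurable_funM.
    apply/measurable_EFinP; apply: measurable_indic.
    exact: sampled_as_measurable.
  exact/measurable_EFinP.
- by move=> f w _; rewrite mule_ge0// lee_fin.
rewrite big_enum/=.
transitivity (\sum_(f in FF) (((\prod_i t.1 (z0 i) ord0) *
    \prod_(e | E e) (bernoulli_pmf rho (f e) * G e (f e)))%:E))%E; last first.
  rewrite sumEFin -mulr_sumr; congr (_ * _)%:E.
  by apply/esym; exact: (big_distr_big false E predT).
apply: eq_bigr => f _.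
transitivity (\int[P]_(w in z @^-1` [set z0] `&` sampled_as r (fun i j => f (i, j)))
   (\prod_(e | E e) g e (f e) (y w e.1 e.2))%:E)%E.
  rewrite integral_mkcondr; apply: eq_integral => w _.
  by rewrite patchE indicE; case: ifP; rewrite ?mul1e ?mul0e.
rewrite (@ge0_integral_prod_rectangles _ _ _ _ _ P mu _ _ E
  (fun e w => y w e.1 e.2) (fun e u => phi b psi u (t.2 (z0 e.1) (z0 e.2)))
  ((\prod_i t.1 (z0 i) ord0) * \prod_(e | E e) bernoulli_pmf rho (f e)) _ _ _ _ _ _
  (fun e => g e (f e)))//.
- rewrite (eq_bigr (fun e => (G e (f e))%:E)); last by move=> e Ee; rewrite gG.
  by rewrite prodEFin -EFinM big_split/= mulrA.
- by move=> e Ee; exact: my.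
- by move=> e u; rewrite mulr_ge0// expR_ge0.
- rewrite mulr_ge0 ?prodr_ge0// => e _; exact: bernoulli_pmf_ge0.
- move=> B mB.
  have -> : z @^-1` [set z0] `&` sampled_as r (fun i j => f (i, j)) `&`
     [set w | forall e, E e -> B e (y w e.1 e.2)] =
     z @^-1` [set z0] `&` dyads_in y (fun i j => B (i, j)) `&`
       sampled_as r (fun i j => f (i, j)).
    rewrite -setIA [X in _ `&` X]setIC setIA; congr (_ `&` _ `&` _).
    apply/seteqP; split => w yB; first by move=> i j ij; exact: (yB (i, j)).
    by move=> [i j]; exact: yB.
  have mB' i j : measurable (B (i, j)) by exact: mB.
  apply: eq_trans (Pr z0 (fun i j => B (i, j)) (fun i j => f (i, j)) mB') _.
  rewrite Py// Pz EFinM -!muleA; congr (_ * _)%E; rewrite muleC.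
  congr (_ * _)%E; last by apply: eq_bigr => -[i j].
  by congr EFin; apply: eq_bigr => -[i j].
Qed.

(** * Square roots of likelihood ratios *)

Section Amplitude.
Variables (R : realType) (Q n : nat) (psi : R -> R).
Implicit Types (t : param R Q) (z : {ffun 'I_n -> 'I_Q}) (r : rel 'I_n)
  (y : 'M[R]_n).

(** The square root of the complete likelihood, without the base density: the
    latter is common to all label vectors and parameters. *)
Definition amplitude r y z t : R :=
  (\prod_i Num.sqrt (t.1 (z i) ord0)) *
  \prod_(e : 'I_n * 'I_n | (e.1 != e.2) && r e.1 e.2)
     expR ((t.2 (z e.1) (z e.2) * y e.1 e.2 - psi (t.2 (z e.1) (z e.2))) / 2).

Definition base_weight (b : R -> R) r y : R :=
  \prod_(e : 'I_n * 'I_n | (e.1 != e.2) && r e.1 e.2) b (y e.1 e.2).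

Lemma complete_lik_amplitude b r y z t : (forall q, 0 <= t.1 q ord0) ->
  complete_lik b psi r y z t = base_weight b r y * amplitude r y z t ^+ 2.
Proof.
move=> t0; rewrite /complete_lik /base_weight /amplitude exprMn mulrCA.
rewrite -!prodrXl -big_split/=; congr (_ * _).
  by apply: eq_bigr => i _; rewrite sqr_sqrtr.
apply: eq_bigr => e _; rewrite /phi expr2 -expRD.
by congr (_ * expR _); lra.
Qed.

Lemma amplitude_ge0 r y z t : 0 <= amplitude r y z t.
Proof.
by rewrite mulr_ge0 ?prodr_ge0// => *; rewrite ?sqrtr_ge0 ?expR_ge0.
Qed.

Lemma amplitude_gt0 r y z t : (forall q, 0 < t.1 q ord0) ->
  0 < amplitude r y z t.
Proof.
by move=> t0; rewrite mulr_gt0 ?prodr_gt0// => *; rewrite ?sqrtr_gt0 ?expR_gt0.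
Qed.

End Amplitude.

(** The Bhattacharyya coefficient of the two members of the family with
    parameters x and a. *)
Definition affinity (R : realType) (psi : R -> R) (x a : R) : R :=
  expR (psi ((x + a) / 2) - (psi x + psi a) / 2).

(** Up to normalization, the geometric mean of two members of an exponential
    family is the member with the average parameter. *)
Lemma integral_root_ratio_phi (R : realType)
    (mu : {measure set (measurableTypeR R) -> \bar R}) (b psi : R -> R)
    (x a : R) :
  measurable_fun [set: measurableTypeR R] (b : measurableTypeR R -> R) ->
  (forall u, 0 <= b u) ->
  (\int[mu]_u (phi b psi u ((x + a) / 2))%:E = 1)%E ->
  (\int[mu]_u (expR ((x * u - psi x) / 2) / expR ((a * u - psi a) / 2) *
                phi b psi u a)%:E = (affinity psi x a)%:E)%E.
Proof.
move=> mb b0 int1.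
transitivity (\int[mu]_u ((affinity psi x a)%:E *
    (phi b psi u ((x + a) / 2))%:E))%E.
  apply: eq_integral => u _; rewrite -EFinM /phi /affinity -expRN -expRD.
  rewrite mulrCA -expRD [in RHS]mulrCA -expRD; congr (_ * expR _)%:E.
  lra.
rewrite ge0_integralZl//.
- by rewrite int1 mule1.
- apply/measurable_EFinP; apply: measurable_funM => //; apply: measurableT_comp => //.
  by apply: measurable_funB => //; exact: measurable_funM.
- by move=> u _; rewrite lee_fin mulr_ge0// expR_ge0.
- by rewrite lee_fin expR_ge0.
Qed.

(** The mean, on the event that z0 is the true label vector, of the amplitude
    of (z1, t) divided by that of (z0, ts).  The probability of this event
    turns the proportions of z0 from denominator into numerator. *)
Definition mean_amplitude_ratio (R : realType) (Q n : nat) (psi : R -> R)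
    (rho : R) (ts t : param R Q) (z1 z0 : {ffun 'I_n -> 'I_Q}) : R :=
  (\prod_i Num.sqrt (t.1 (z1 i) ord0 * ts.1 (z0 i) ord0)) *
  \prod_(e : 'I_n * 'I_n | e.1 != e.2)
     (1 - rho + rho * affinity psi (t.2 (z1 e.1) (z1 e.2))
                                   (ts.2 (z0 e.1) (z0 e.2))).

Lemma sbm_integral_amplitude (R : realType) (Q n : nat) (d : measure_display)
    (T : measurableType d) (P : probability T R)
    (mu : {measure set (measurableTypeR R) -> \bar R}) (b psi : R -> R)
    (ts t : param R Q) (rho : R) (z : T -> {ffun 'I_n -> 'I_Q})
    (y : T -> 'M[R]_n) (r : T -> rel 'I_n) (z0 z1 : {ffun 'I_n -> 'I_Q}) :
  sbm_dyad_sample P mu b psi ts rho z y r ->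
  measurable_fun [set: measurableTypeR R] (b : measurableTypeR R -> R) ->
  (forall u, 0 <= b u) -> (forall q, 0 < ts.1 q ord0) -> 0 <= rho <= 1 ->
  (forall q l, \int[mu]_u (phi b psi u (ts.2 q l))%:E = 1)%E ->
  (forall q l q' l',
    \int[mu]_u (phi b psi u ((t.2 q l + ts.2 q' l') / 2))%:E = 1)%E ->
  measurable_fun [set: T] (fun w => amplitude psi (r w) (y w) z1 t /
                                    amplitude psi (r w) (y w) z0 ts) /\
  (\int[P]_(w in z @^-1` [set z0])
     (amplitude psi (r w) (y w) z1 t / amplitude psi (r w) (y w) z0 ts)%:E =
   (mean_amplitude_ratio psi rho ts t z1 z0)%:E)%E.
Proof.
move=> sam mb b0 ts0 rho01 ints inth.
pose g (e : 'I_n * 'I_n) (c : bool) (u : R) : R :=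
  let x := t.2 (z1 e.1) (z1 e.2) in let a := ts.2 (z0 e.1) (z0 e.2) in
  if c then expR ((x * u - psi x) / 2) / expR ((a * u - psi a) / 2) else 1.
have mlin (x a c : R) : measurable_fun [set: measurableTypeR R]
    ((fun u => expR ((x * u - a) / c)) : measurableTypeR R -> R).
  apply: measurableT_comp => //; apply: measurable_funM => //.
  by apply: measurable_funB => //; exact: measurable_funM.
have mg e c : measurable_fun [set: measurableTypeR R]
    (g e c : measurableTypeR R -> R).
  rewrite /g; case: c => //; apply: measurable_funM => //.
  by under eq_fun do rewrite -expRN; apply: measurableT_comp => //; apply: measurable_funN;
    apply: measurable_funM => //; apply: measurable_funB => //; exact: measurable_funM.
pose w01 := (\prod_i Num.sqrt (t.1 (z1 i) ord0)) /
            \prod_i Num.sqrt (ts.1 (z0 i) ord0).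
have E w : amplitude psi (r w) (y w) z1 t / amplitude psi (r w) (y w) z0 ts =
    w01 * \prod_(e : 'I_n * 'I_n | e.1 != e.2) g e (r w e.1 e.2) (y w e.1 e.2).
  rewrite /amplitude invfM mulrACA; congr (_ * _).
  by rewrite -prodf_div big_mkcondr.
have [[mz my mr] _ _ _] := sam.
split.
  under eq_fun do rewrite E; apply: measurable_funM => //.
  under eq_fun do rewrite -big_filter.
  apply: measurable_prod => -[i j]; rewrite mem_filter => /andP[ij _].
  rewrite /g/=; apply: measurable_fun_ifT => //; first exact: mr.
  exact: (measurableT_comp (mg (i, j) true) (my i j ij)).
under eq_integral do rewrite E EFinM.
have g0 e c u : 0 <= g e c u.
  by rewrite /g; case: c => //; rewrite divr_ge0// expR_ge0.
rewrite ge0_integralZl//; last first.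
- by rewrite lee_fin divr_ge0// prodr_ge0// => i _; rewrite sqrtr_ge0.
- by move=> w _; rewrite lee_fin prodr_ge0.
- apply/measurable_EFinP; apply: measurable_funTS.
  under eq_fun do rewrite -big_filter.
  apply: measurable_prod => -[i j]; rewrite mem_filter => /andP[ij _].
  rewrite /g/=; apply: measurable_fun_ifT => //; first exact: mr.
  exact: (measurableT_comp (mg (i, j) true) (my i j ij)).
pose G e (c : bool) := if c then affinity psi (t.2 (z1 e.1) (z1 e.2))
                                    (ts.2 (z0 e.1) (z0 e.2)) else 1.
rewrite (@sbm_integral_dyads _ _ _ _ _ _ _ _ _ _ _ _ _ _ z0 g G sam)//; last 2 first.
- by move=> q; exact: ltW.
- move=> e [] _; first exact: integral_root_ratio_phi.
  by rewrite /g /G/=; under eq_integral do rewrite mul1r.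
rewrite -EFinM mulrA; congr (_ * _)%:E.
  rewrite /w01 -prodf_div -big_split/=.
  apply: eq_bigr => i _; have si := ts0 (z0 i).
  rewrite [in RHS]mulrC sqrtrM ?ltW// -{2}(sqr_sqrtr (ltW si)).
  have : Num.sqrt (ts.1 (z0 i) ord0) != 0 by rewrite sqrtr_eq0 -ltNge.
  by move=> s0; field.
apply: eq_bigr => e _.
by rewrite big_bool /bernoulli_pmf /G/= mulr1 addrC.
Qed.

(** * Misclassified nodes and informative dyads *)

Section Misclassified.
Local Open Scope set_scope.
Local Open Scope ring_scope.

Lemma sub1_mul_card_le_offdiag (I : finType) (A B : {set I}) (E : {set I * I}) :
  (forall i j, i \in A -> j \in B -> i != j -> (i, j) \in E) ->
  (#|A| * #|B|.-1 <= #|E|)%N.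
Proof.
move=> AB; rewrite -subn1 mulnBr muln1 -cardsX leq_subLR.
apply: leq_trans (_ : #|[set (i, i) | i in A] :|: E| <= _)%N; last first.
  apply: leq_trans (leq_card_setU _ _) _; rewrite leq_add2r.
  exact: leq_imset_card.
apply: subset_leq_card; apply/fintype.subsetP => -[i j]; rewrite !inE/= => /andP[iA jB].
have [<-|ij] := eqVneq i j; last by rewrite AB ?orbT.
by apply/orP; left; apply/imsetP; exists i.
Qed.

Variables (R : realType) (Q n : nat).
Implicit Types (z : {ffun 'I_n -> 'I_Q}) (s : {ffun 'I_Q -> 'I_Q}).

(** The map s translates the classes of z into those of z0 and may merge some
    of them. *)
Definition misclassified s z z0 : {set 'I_n} := [set i | s (z i) != z0 i].

Definition balanced (gam : R) z0 : bool :=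
  [forall q, gam * n%:R <= #|[set i | z0 i == q]|%:R].

Definition far_dyads (eps : R) (x a : 'M[R]_Q) z z0 : {set 'I_n * 'I_n} :=
  [set e | (e.1 != e.2) &&
    (eps <= `|x (z e.1) (z e.2) - a (z0 e.1) (z0 e.2)|)].

Definition same_partition z z0 : bool :=
  [exists s : 'S_Q, z == [ffun i => s (z0 i)]].

Lemma misclassified0_same_partition s z z0 : injective s ->
  misclassified s z z0 = finset.set0 -> same_partition z z0.
Proof.
move=> sI M0; apply/existsP; exists (perm sI)^-1%g; apply/eqP/ffunP => i.
rewrite ffunE; apply: (@perm_inj _ (perm sI)); rewrite permKV permE.
have : i \notin misclassified s z z0 by rewrite M0 finset.in_set0.
by rewrite inE negbK => /eqP.
Qed.

(** A map that is not injective misses some true class, all of whose nodes are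
    then misclassified. *)
Lemma misclassified_noninjective gam s z z0 : balanced gam z0 ->
  ~~ injectiveb s -> gam * n%:R <= #|misclassified s z z0|%:R.
Proof.
move=> /forallP bal ninj.
have [q qs] : exists q, q \notin codom s.
  apply/existsP; rewrite -negb_forall; apply: contra ninj => /forallP sur.
  apply/card_uniqP; rewrite size_codom; apply: eq_card => q.
  by rewrite sur.
apply: le_trans (bal q) _; rewrite ler_nat; apply: subset_leq_card.
apply/fintype.subsetP => i; rewrite !inE => /eqP ->.
by apply: contra qs => /eqP <-; exact: codom_f.
Qed.

(** Relabel each estimated class by the true class that dominates it.  A
    sizeable misclassified part of a class k then meets, together with the
    dominating part, two rows of a that differ in some column l; whatever the
    value x k l', it is far from one of the two entries. *)
Lemma far_dyads_misclassified (gam eps : R) (x a : 'M[R]_Q) z z0 :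
  (0 < Q)%N ->
  (forall q1 q2, q1 != q2 -> exists l, 2 * eps <= `|a q1 l - a q2 l|) ->
  balanced gam z0 -> 2 * Q%:R <= gam * n%:R ->
  exists s : {ffun 'I_Q -> 'I_Q},
    gam / (2 * Q%:R ^+ 3) * n%:R * #|misclassified s z z0|%:R <=
      #|far_dyads eps x a z z0|%:R.
Proof.
move=> Q0 rows /forallP bal nbig; have q0 : 'I_Q := Ordinal Q0.
have QR0 : 0 < Q%:R :> R by rewrite ltr0n.
pose N k q := #|[set i | (z i == k) && (z0 i == q)]|.
pose s := [ffun k => [arg max_(q > q0) N k q]%N] : {ffun 'I_Q -> 'I_Q}.
have smax k q : (N k q <= N k (s k))%N.
  by rewrite ffunE; case: arg_maxnP => // p _; apply.
exists s; set r := #|misclassified s z z0|.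
pose F (p : 'I_Q * 'I_Q) := ((p.2 != s p.1) * N p.1 p.2)%N.
pose p := [arg max_(p > (q0, q0)) F p]%N.
have pmax p' : (F p' <= F p)%N by rewrite /p; case: arg_maxnP => // p1 _; apply.
have rF : (r <= Q ^ 2 * F p)%N.
  have -> : (Q ^ 2 * F p = \sum_(p' : 'I_Q * 'I_Q) F p)%N.
    by rewrite sum_nat_const card_prod card_ord.
  apply: leq_trans (leq_sum _ (fun p' _ => pmax p')).
  rewrite /r -sum1_card (partition_big (fun i => (z i, z0 i)) predT)//=.
  apply: leq_sum => -[k q] _; rewrite /F/=; have [->|qs] := eqVneq q (s k).
    rewrite mul0n leqn0 big1// => i; rewrite inE => /andP[mi /eqP[zi z0i]].
    by move: mi; rewrite zi z0i eqxx.
  rewrite mul1n /N -sum1_card big_mkcond [X in (_ <= X)%N]big_mkcond/=.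
  apply: leq_sum => i _; rewrite !inE xpair_eqE.
  by case: (_ != _) => //=; case: (_ && _).
have [r0|rpos] := posnP r; first by rewrite r0 mulr0.
have Fpos : (0 < F p)%N.
  rewrite lt0n; apply: contraL rpos => /eqP F0.
  by rewrite -leqNgt (leq_trans rF)// F0 muln0.
move: rF Fpos; rewrite /F; set k := p.1; set q1 := p.2.
have [->|q1s] := eqVneq q1 (s k) => //=; rewrite mul1n => rN _.
have [l gl] := rows _ _ q1s.
pose l' := [arg max_(l' > q0) N l' l]%N.
have l'max k' : (N k' l <= N l' l)%N by rewrite /l'; case: arg_maxnP => // p1 _; apply.
have Nl : gam * n%:R <= Q%:R * (N l' l)%:R.
  apply: le_trans (bal l) _; rewrite -natrM ler_nat.
  have -> : (Q * N l' l = \sum_(k' : 'I_Q) N l' l)%N by rewrite sum_nat_const card_ord.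
  apply: leq_trans (leq_sum _ (fun k' _ => l'max k')).
  rewrite -sum1_card (partition_big z predT)//=; apply: leq_sum => k' _.
  rewrite /N -sum1_card big_mkcond [X in (_ <= X)%N]big_mkcond/=.
  by apply: leq_sum => i _; rewrite !inE andbC.
have [qa Nqa far] : exists2 qa, (N k q1 <= N k qa)%N & eps <= `|x k l' - a qa l|.
  have [h|h] := leP eps `|x k l' - a q1 l|; first by exists q1.
  exists (s k); first exact: smax.
  rewrite leNgt; apply/negP => h2; move: gl; rewrite leNgt => /negP; apply.
  have -> : a q1 l - a (s k) l = (x k l' - a (s k) l) - (x k l' - a q1 l) by ring.
  by apply: le_lt_trans (ler_normB _ _) _; lra.
have Hcard := @sub1_mul_card_le_offdiag 'I_n [set i | (z i == k) && (z0 i == qa)]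
  [set i | (z i == l') && (z0 i == l)] (far_dyads eps x a z z0).
have {Hcard} : (N k qa * (N l' l).-1 <= #|far_dyads eps x a z z0|)%N.
  apply: Hcard => i j; rewrite !inE/= => /andP[/eqP -> /eqP ->] /andP[/eqP -> /eqP ->] ->.
  by rewrite far.
rewrite -(ler_nat R) natrM; apply: le_trans.
have Npos : (0 < N l' l)%N.
  rewrite lt0n; apply/negP => /eqP N0; move: Nl; rewrite N0 mulr0.
  by rewrite leNgt (lt_le_trans _ nbig)// mulr_gt0.
have Npred : gam * n%:R / (2 * Q%:R) <= (N l' l).-1%:R.
  rewrite -[(N l' l).-1]subn1 natrB// ler_pdivrMr ?mulr_gt0// mulrBl; lra.
have rN' : r%:R / Q%:R ^+ 2 <= (N k qa)%:R :> R.
  rewrite ler_pdivrMr ?exprn_gt0// mulrC -natrX -natrM ler_nat.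
  by apply: leq_trans rN _; rewrite leq_mul2l Nqa orbT.
have -> : gam / (2 * Q%:R ^+ 3) * n%:R * r%:R =
    r%:R / Q%:R ^+ 2 * (gam * n%:R / (2 * Q%:R)).
  have Qn0 : Q%:R != 0 :> R by rewrite gt_eqF.
  by field.
apply: ler_pM => //.
have gn0 : 0 <= gam * n%:R by apply: le_trans nbig; rewrite mulr_ge0.
by rewrite divr_ge0// mulr_ge0.
Qed.

End Misclassified.

(** * Exponential bounds for the mean amplitudes *)

(** The quadratic correction to the arithmetic-geometric inequality separates
    distinct proportions. *)
Lemma sqrtM_le_mean (R : realType) (a b : R) : 0 <= a <= 1 -> 0 <= b <= 1 ->
  Num.sqrt (a * b) <= (a + b) / 2 - (a - b) ^+ 2 / 8.
Proof.
move=> /andP[a0 a1] /andP[b0 b1]; rewrite sqrtrM//.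
have s0 := sqrtr_ge0 a; have t0 := sqrtr_ge0 b.
have s1 : Num.sqrt a <= 1 by rewrite -sqrtr1 ler_wsqrtr.
have t1 : Num.sqrt b <= 1 by rewrite -sqrtr1 ler_wsqrtr.
rewrite -{2 3}(sqr_sqrtr a0) -{2 3}(sqr_sqrtr b0).
set s := Num.sqrt a in s0 s1 *; set t := Num.sqrt b in t0 t1 *.
have st : (s + t) ^+ 2 <= 2 ^+ 2 by rewrite lerXn2r ?nnegrE ?addr_ge0//; lra.
have : (s - t) ^+ 2 * (s + t) ^+ 2 <= (s - t) ^+ 2 * 2 ^+ 2.
  by rewrite ler_wpM2l// sqr_ge0.
have -> : (s ^+ 2 - t ^+ 2) ^+ 2 = (s - t) ^+ 2 * (s + t) ^+ 2 by ring.
by rewrite !expr2; lra.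
Qed.

Lemma sum_prod_labels (R : realType) (Q n : nat) (w : 'I_Q -> 'I_Q -> R) :
  \sum_(z0 : {ffun 'I_n -> 'I_Q}) \sum_(z : {ffun 'I_n -> 'I_Q})
    \prod_i w (z i) (z0 i) = (\sum_k \sum_q w k q) ^+ n.
Proof.
transitivity (\sum_(z0 : {ffun 'I_n -> 'I_Q}) \prod_i \sum_k w k (z0 i)).
  by apply: eq_bigr => z0 _; rewrite bigA_distr_bigA.
rewrite -(bigA_distr_bigA (fun _ q => \sum_k w k q)) prodr_const card_ord.
by rewrite exchange_big.
Qed.

Section MeanAmplitude.
Variables (R : realType) (Q n : nat) (psi : R -> R) (rho h eps : R).
Variables (ts t : param R Q).
Implicit Types z : {ffun 'I_n -> 'I_Q}.
Hypotheses (Q_gt0 : (0 < Q)%N) (n_gt0 : (0 < n)%N).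
Hypotheses (rho01 : 0 <= rho <= 1) (h_gt0 : 0 < h).
Hypotheses (t01 : forall q, 0 <= t.1 q ord0 <= 1)
  (ts01 : forall q, 0 <= ts.1 q ord0 <= 1).
Hypotheses (sum_t : \sum_q t.1 q ord0 <= 1 + Q%:R / n%:R)
  (sum_ts : \sum_q ts.1 q ord0 = 1).
Hypothesis aff_le1 : forall q l q' l', affinity psi (t.2 q l) (ts.2 q' l') <= 1.
Hypothesis aff_far : forall q l q' l', eps <= `|t.2 q l - ts.2 q' l'| ->
  affinity psi (t.2 q l) (ts.2 q' l') <= 1 - h.

Let weight k q : R := Num.sqrt (t.1 k ord0 * ts.1 q ord0).

Let weight_ge0 k q : 0 <= weight k q. Proof. exact: sqrtr_ge0. Qed.

Let weight_le k q : weight k q <= (t.1 k ord0 + ts.1 q ord0) / 2.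
Proof.
apply: le_trans (sqrtM_le_mean (t01 k) (ts01 q)) _.
by rewrite gerBl divr_ge0// sqr_ge0.
Qed.

Lemma mean_amplitude_ratio_le z1 z0 :
  mean_amplitude_ratio psi rho ts t z1 z0 <=
  (\prod_i weight (z1 i) (z0 i)) *
    expR (- (rho * h * #|far_dyads eps t.2 ts.2 z1 z0|%:R)).
Proof.
have /andP[rho0 rho1] := rho01.
rewrite ler_wpM2l ?prodr_ge0//.
have -> : expR (- (rho * h * #|far_dyads eps t.2 ts.2 z1 z0|%:R)) =
    \prod_(e : 'I_n * 'I_n | e.1 != e.2)
      (if eps <= `|t.2 (z1 e.1) (z1 e.2) - ts.2 (z0 e.1) (z0 e.2)|
       then expR (- (rho * h)) else 1).
  rewrite -big_mkcondr/= -mulNr expRM_natr -prodr_const.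
  by apply: eq_bigl => e; rewrite inE.
apply: ler_prod => e _.
have a0 : 0 <= affinity psi (t.2 (z1 e.1) (z1 e.2)) (ts.2 (z0 e.1) (z0 e.2)).
  exact: expR_ge0.
apply/andP; split; first by rewrite addr_ge0 ?subr_ge0 ?mulr_ge0.
case: ifPn => [/aff_far|_].
  move=> af; apply: le_trans (expR_ge1Dx _).
  have : rho * affinity psi (t.2 (z1 e.1) (z1 e.2)) (ts.2 (z0 e.1) (z0 e.2)) <=
    rho * (1 - h) by rewrite ler_wpM2l.
  by lra.
have := ler_wpM2l rho0 (aff_le1 (z1 e.1) (z1 e.2) (z0 e.1) (z0 e.2)).
by lra.
Qed.

Let total_weight : \sum_k \sum_q weight k q <= Q%:R ^+ 2.
Proof.
apply: (@le_trans _ R (\sum_(k < Q) \sum_(q < Q) (1 : R))).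
  apply: ler_sum => k _; apply: ler_sum => q _; apply: le_trans (weight_le k q) _.
  by have /andP[_ h1] := t01 k; have /andP[_ h2] := ts01 q; lra.
by rewrite !sumr_const card_ord -mulrnA -natrX expnS expn1.
Qed.

Let matched_weight (s : 'I_Q -> 'I_Q) : injective s ->
  \sum_k weight k (s k) <= 1 + Q%:R / n%:R.
Proof.
move=> sI; apply: (@le_trans _ R (\sum_k (t.1 k ord0 + ts.1 (s k) ord0) / 2)).
  by apply: ler_sum => k _; exact: weight_le.
rewrite -mulr_suml big_split/= -(reindex_inj sI (P := predT)
  (F := fun q => ts.1 q ord0))/= sum_ts.
have : 0 <= Q%:R / n%:R :> R by rewrite divr_ge0.
by have := sum_t; lra.
Qed.

(** Both label vectors are summed at once: the exponential of the number of
    misclassified nodes is a product over nodes, so the double sum is the n-th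
    power of a sum over pairs of classes. *)
Lemma sum_mean_amplitude_misaligned (gam lam : R) :
  (forall q1 q2, q1 != q2 ->
    exists l, 2 * eps <= `|ts.2 q1 l - ts.2 q2 l|) ->
  0 < gam -> 2 * Q%:R <= gam * n%:R ->
  lam = rho * h * (gam / (2 * Q%:R ^+ 3)) * n%:R ->
  \sum_(z0 : {ffun 'I_n -> 'I_Q} | balanced gam z0)
    \sum_(z | ~~ same_partition z z0)
     mean_amplitude_ratio psi rho ts t z z0 <=
  #|{ffun 'I_Q -> 'I_Q}|%:R *
    (expR (- (lam / 2)) * expR (Q%:R + n%:R * Q%:R ^+ 2 * expR (- (lam / 2))) +
     (Q%:R ^+ 2 * expR (- (lam * gam))) ^+ n).
Proof.
move=> rows gam0 nbig lamE; set tau := expR (- (lam / 2)).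
have /andP[rho0 _] := rho01.
have QR0 : 0 < Q%:R :> R by rewrite ltr0n.
have lam0 : 0 <= lam.
  by rewrite lamE !mulr_ge0 ?invr_ge0 ?mulr_ge0 ?exprn_ge0// ltW.
have tau0 : 0 <= tau by exact: expR_ge0.
have tau1 : tau <= 1 by rewrite /tau expR_le1 oppr_le0 divr_ge0.
(* For injective s, the second half of the penalty expR (- lam * m) is kept as a product over
   nodes; the first half supplies the small prefactor, since m >= 1. *)
pose pen (s : {ffun 'I_Q -> 'I_Q}) (z z0 : {ffun 'I_n -> 'I_Q}) : R :=
  if injectiveb s then tau * \prod_i (if s (z i) == z0 i then 1 else tau)
  else expR (- (lam * gam)) ^+ n.
have pen0 s z z0 : 0 <= pen s z z0.
  rewrite /pen; case: ifP => _; last by rewrite exprn_ge0 ?expR_ge0.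
  by rewrite mulr_ge0 ?prodr_ge0// => i _; case: ifP.
have W0 (z z0 : {ffun 'I_n -> 'I_Q}) : 0 <= \prod_i weight (z i) (z0 i).
  by rewrite prodr_ge0.
apply: (@le_trans _ R (\sum_(z0 : {ffun 'I_n -> 'I_Q}) \sum_(z : {ffun 'I_n -> 'I_Q})
    \sum_(s : {ffun 'I_Q -> 'I_Q})
    (\prod_i weight (z i) (z0 i)) * pen s z z0)).
  rewrite big_mkcond/=; apply: ler_sum => z0 _; case: ifPn => [bal|_]; last first.
    by do 2![apply: sumr_ge0 => ? _]; rewrite mulr_ge0.
  rewrite big_mkcond/=; apply: ler_sum => z _; case: ifPn => [nsame|_]; last first.
    by apply: sumr_ge0 => ? _; rewrite mulr_ge0.
  have [s far] := far_dyads_misclassified t.2 z Q_gt0 rows bal nbig.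
  rewrite (bigD1 s)//= -[leLHS]addr0; apply: lerD; last first.
    by apply: sumr_ge0 => ? _; rewrite mulr_ge0.
  apply: le_trans (mean_amplitude_ratio_le z z0) _; rewrite ler_wpM2l//.
  set m := #|misclassified s z z0| in far.
  apply: (@le_trans _ R (expR (- (lam * m%:R)))).
    rewrite ler_expR lerN2 (_ : lam * m%:R = rho * h *
      (gam / (2 * Q%:R ^+ 3) * n%:R * m%:R)); last by rewrite lamE !mulrA.
    by apply: ler_wpM2l => //; apply: mulr_ge0 => //; exact: ltW.
  rewrite /pen; case: ifPn => sI; last first.
    rewrite -expRM_natr ler_expR mulNr lerN2 -mulrA ler_wpM2l//.
    exact: misclassified_noninjective bal sI.
  have -> : \prod_i (if s (z i) == z0 i then 1 else tau) = tau ^+ m.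
    rewrite /m -prodr_const big_mkcond [RHS]big_mkcond/=.
    by apply: eq_bigr => i _; rewrite inE; case: eqP.
  have m0 : (0 < m)%N.
    rewrite card_gt0; apply: contra nsame => /eqP.
    exact/misclassified0_same_partition/injectiveP.
  have -> : expR (- (lam * m%:R)) = tau ^+ m * tau ^+ m.
    by rewrite -expRM_natr -expRD; congr expR; lra.
  rewrite ler_wpM2r ?exprn_ge0// -(prednK m0) exprS ler_piMr//.
  by rewrite exprn_ile1.
under eq_bigr do rewrite exchange_big/=.
rewrite exchange_big/=.
apply: (@le_trans _ R (\sum_(s : {ffun 'I_Q -> 'I_Q})
  (tau * expR (Q%:R + n%:R * Q%:R ^+ 2 * tau) +
     (Q%:R ^+ 2 * expR (- (lam * gam))) ^+ n))); last first.
  by rewrite sumr_const [leRHS]mulr_natl lexx.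
apply: ler_sum => s _; have [sI|sI] := boolP (injectiveb s).
  rewrite /pen sI -[leLHS]addr0; apply: lerD; last first.
    by rewrite exprn_ge0// mulr_ge0 ?exprn_ge0 ?expR_ge0.
  under eq_bigr do under eq_bigr do rewrite mulrCA -big_split/=.
  under eq_bigr do rewrite -mulr_sumr.
  rewrite -mulr_sumr ler_wpM2l//.
  rewrite (sum_prod_labels n (fun k q => weight k q * (if s k == q then 1 else tau))).
  rewrite [n%:R * _]mulrC -mulrA.
  have -> : Q%:R + Q%:R ^+ 2 * (n%:R * tau) = (Q%:R / n%:R + Q%:R ^+ 2 * tau) * n%:R :> R.
    have nR0 : n%:R != 0 :> R by rewrite pnatr_eq0 -lt0n.
    by field.
  rewrite expRM_natr lerXn2r ?nnegrE ?expR_ge0//.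
    by do 2![apply: sumr_ge0 => ? _]; rewrite mulr_ge0//; case: ifP.
  apply: le_trans (expR_ge1Dx _); rewrite addrA.
  apply: (@le_trans _ R (\sum_k weight k (s k) + (\sum_k \sum_q weight k q) * tau)).
    rewrite mulr_suml -big_split/=; apply: ler_sum => k _.
    rewrite mulr_suml (bigD1 (s k))//= eqxx mulr1 lerD2l.
    rewrite [leRHS](bigD1 (s k))//= -[leLHS]add0r lerD ?mulr_ge0//.
    by apply: ler_sum => q; rewrite eq_sym => /negPf ->.
  by apply: lerD; [apply/matched_weight/injectiveP|rewrite ler_wpM2r].
rewrite /pen (negPf sI) -[leLHS]add0r; apply: lerD.
  by rewrite mulr_ge0 ?expR_ge0.
under eq_bigr do rewrite -mulr_suml.
rewrite -mulr_suml sum_prod_labels exprMn ler_wpM2r ?exprn_ge0 ?expR_ge0//.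
rewrite lerXn2r ?nnegrE ?exprn_ge0//.
by do 2![apply: sumr_ge0 => ? _].
Qed.

(** The same label vector but a parameter away from the truth: a discrepancy
    in the proportions costs a factor bounded away from 1 at each node, one in
    the connection parameters costs a positive fraction of the dyads. *)
Lemma sum_mean_amplitude_far_param (gam del : R) :
  0 < gam -> 2 * Q%:R <= gam * n%:R ->
  (exists q, del <= `|t.1 q ord0 - ts.1 q ord0|) \/
  (exists q l, eps <= `|t.2 q l - ts.2 q l|) -> 0 <= del ->
  \sum_(z0 : {ffun 'I_n -> 'I_Q} | balanced gam z0)
     mean_amplitude_ratio psi rho ts t z0 z0 <=
  expR (Q%:R - n%:R * rho * Num.min (del ^+ 2 / 8) (h * gam ^+ 2 / 2)).
Proof.
move=> gam0 nbig far del0; have /andP[rho0 rho1] := rho01.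
have nR0 : 0 < n%:R :> R by rewrite ltr0n.
have n1 : 1 <= n%:R :> R by rewrite ler1n.
have diag (c : R) : 0 <= c ->
    \sum_(z0 : {ffun 'I_n -> 'I_Q}) (\prod_i weight (z0 i) (z0 i)) * c =
    (\sum_q weight q q) ^+ n * c.
  move=> c0; rewrite -mulr_suml; congr (_ * _).
  by rewrite -(bigA_distr_bigA (fun _ q => weight q q)) prodr_const card_ord.
have diag0 : 0 <= \sum_q weight q q by apply: sumr_ge0.
have mn1 : Num.min (del ^+ 2 / 8) (h * gam ^+ 2 / 2) <= del ^+ 2 / 8 by rewrite ge_min lexx.
have mn2 : Num.min (del ^+ 2 / 8) (h * gam ^+ 2 / 2) <= h * gam ^+ 2 / 2
  by rewrite ge_min lexx orbT.
case: far => [[q farq]|[q [l farql]]].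
  apply: (@le_trans _ R ((\sum_q weight q q) ^+ n * 1)).
    rewrite -diag// big_mkcond/=; apply: ler_sum => z0 _; case: ifP => _; last first.
      by rewrite mulr1 prodr_ge0.
    apply: le_trans (mean_amplitude_ratio_le z0 z0) _; rewrite ler_wpM2l ?prodr_ge0//.
    by rewrite expR_le1 oppr_le0 !mulr_ge0// ltW.
  rewrite mulr1; apply: (@le_trans _ R (expR ((Q%:R / n%:R - del ^+ 2 / 8) * n%:R))).
    rewrite expRM_natr lerXn2r ?nnegrE ?expR_ge0//.
    apply: le_trans (expR_ge1Dx _).
    apply: (@le_trans _ R (\sum_q' ((t.1 q' ord0 + ts.1 q' ord0) / 2 -
        (t.1 q' ord0 - ts.1 q' ord0) ^+ 2 / 8))).
      by apply: ler_sum => q' _; exact: sqrtM_le_mean.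
    rewrite sumrB -mulr_suml big_split/= sum_ts.
    have : del ^+ 2 / 8 <= \sum_q' (t.1 q' ord0 - ts.1 q' ord0) ^+ 2 / 8.
      rewrite (bigD1 q)//= -[leLHS]addr0 lerD//.
        rewrite ler_wpM2r ?invr_ge0// -[leRHS]real_normK ?num_real//.
        by rewrite lerXn2r ?nnegrE.
      by apply: sumr_ge0 => q' _; rewrite divr_ge0// sqr_ge0.
    have : 0 <= Q%:R / n%:R :> R by rewrite divr_ge0.
    by have := sum_t; lra.
  rewrite ler_expR mulrBl divfK ?gt_eqF// lerD2l lerN2.
  rewrite -mulrA [leRHS]mulrC ler_wpM2l ?ler0n//; apply: le_trans _ mn1.
  by rewrite ler_piMl// le_min !mulr_ge0 ?sqr_ge0 ?invr_ge0// ltW.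
apply: (@le_trans _ R ((\sum_q weight q q) ^+ n *
    expR (- (n%:R * rho * (h * gam ^+ 2 / 2))))).
  rewrite -diag ?expR_ge0// big_mkcond/=; apply: ler_sum => z0 _.
  case: ifP => [bal|_]; last by rewrite mulr_ge0 ?expR_ge0 ?prodr_ge0.
  apply: le_trans (mean_amplitude_ratio_le z0 z0) _; rewrite ler_wpM2l ?prodr_ge0//.
  rewrite ler_expR lerN2.
  have H := @sub1_mul_card_le_offdiag 'I_n [set i | z0 i == q]%SET
    [set i | z0 i == l]%SET (far_dyads eps t.2 ts.2 z0 z0).
  have {}H : (#|[set i | z0 i == q]%SET| * #|[set i | z0 i == l]%SET|.-1 <=
     #|far_dyads eps t.2 ts.2 z0 z0|)%N.
    by apply: H => i j; rewrite !inE/= => /eqP -> /eqP -> ->.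
  move/forallP: bal => bal; have bq := bal q; have bl := bal l.
  have lpos : (0 < #|[set i | z0 i == l]%SET|)%N.
    by rewrite -(ltr0n R); apply: lt_le_trans bl; rewrite mulr_gt0.
  have bl' : gam * n%:R / 2 <= #|[set i | z0 i == l]%SET|.-1%:R.
    have Q1 : 1 <= Q%:R :> R by rewrite ler1n.
    by rewrite -[_.-1]subn1 natrB//; lra.
  move: H; rewrite -(ler_nat R) natrM => H.
  have gn0 : 0 <= gam * n%:R by rewrite mulr_ge0 ?ler0n// ltW.
  have gn2 : 0 <= gam * n%:R / 2 by rewrite divr_ge0.
  have H2 := le_trans (ler_pM gn0 gn2 bq bl') H.
  have rh0 : 0 <= rho * h by rewrite mulr_ge0// ltW.
  apply: le_trans (ler_wpM2l rh0 H2).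
  have -> : rho * h * (gam * n%:R * (gam * n%:R / 2)) =
    (n%:R * rho * (h * gam ^+ 2 / 2)) * n%:R by ring.
  by rewrite ler_peMr// !mulr_ge0 ?sqr_ge0 ?invr_ge0 ?ler0n// ltW.
rewrite expRD; apply: ler_pM; rewrite ?exprn_ge0 ?expR_ge0//.
  have -> : Q%:R = Q%:R / n%:R * n%:R :> R by rewrite divfK ?gt_eqF.
  rewrite expRM_natr lerXn2r ?nnegrE ?expR_ge0//.
  apply: le_trans (expR_ge1Dx _).
  exact: (@matched_weight id).
by rewrite ler_expR lerN2 ler_wpM2l ?mulr_ge0.
Qed.

End MeanAmplitude.

(** Exponential Markov inequality: tilting the class q by expR (-1) lowers the
    total mass of each node by at least c / 2, against a gain c / 4 from the
    size of the class. *)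
Lemma sum_unbalanced_le (R : realType) (Q n : nat) (al : 'I_Q -> R) (c : R) :
  (forall q, c <= al q) -> 0 < c -> \sum_q al q = 1 ->
  \sum_(z0 : {ffun 'I_n -> 'I_Q} | ~~ balanced (c / 4) z0)
     \prod_i al (z0 i) <= Q%:R * expR (- (c / 4 * n%:R)).
Proof.
move=> cal c0 sal; have al0 q : 0 <= al q by apply: le_trans (cal q); exact: ltW.
pose w (q k : 'I_Q) : R := if k == q then expR (-1) else 1.
have w0 q k : 0 <= w q k by rewrite /w; case: ifP; rewrite ?expR_ge0.
apply: (@le_trans _ R (\sum_q \sum_(z0 : {ffun 'I_n -> 'I_Q})
    expR (c / 4 * n%:R) * \prod_i (al (z0 i) * w q (z0 i)))).
  rewrite exchange_big/= [leLHS]big_mkcond/=; apply: ler_sum => z0 _.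
  case: ifPn => [|_]; last first.
    apply: sumr_ge0 => q _; rewrite mulr_ge0 ?expR_ge0 ?prodr_ge0// => i _.
    by rewrite mulr_ge0.
  rewrite negb_forall => /existsP[q]; rewrite -ltNge => Nq.
  rewrite (bigD1 q)//= -[leLHS]addr0 lerD//; last first.
    apply: sumr_ge0 => q' _; rewrite mulr_ge0 ?expR_ge0 ?prodr_ge0// => i _.
    by rewrite mulr_ge0.
  rewrite big_split/= mulrCA ler_peMr ?prodr_ge0//.
  have -> : \prod_i w q (z0 i) = expR (- #|[set i | z0 i == q]%SET|%:R).
    rewrite /w -big_mkcond/= -[X in _ = expR X]mulN1r expRM_natr -prodr_const.
    by apply: eq_bigl => i; rewrite inE.
  by rewrite -expRD -[leLHS]expR0 ler_expR subr_ge0 ltW.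
apply: (@le_trans _ R (\sum_(q < Q) expR (- (c / 4 * n%:R)))); last first.
  by rewrite sumr_const card_ord [leRHS]mulr_natl lexx.
apply: ler_sum => q _; rewrite -mulr_sumr.
rewrite -(bigA_distr_bigA (fun _ k => al k * w q k)) prodr_const card_ord.
apply: (@le_trans _ R (expR (c / 4 * n%:R) * expR (- (c / 2) * n%:R))); last first.
  by rewrite -expRD ler_expR; lra.
rewrite ler_wpM2l ?expR_ge0// expRM_natr lerXn2r ?nnegrE ?expR_ge0//.
  by apply: sumr_ge0 => k _; rewrite mulr_ge0.
apply: le_trans (expR_ge1Dx _).
have -> : \sum_k al k * w q k = 1 - al q * (1 - expR (-1)).
  have rest : \sum_(k | k != q) al k = 1 - al q.
    by have := sal; rewrite (bigD1 q)//=; lra.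
  rewrite (bigD1 q)//= /w eqxx (eq_bigr al); first by rewrite rest; ring.
  by move=> k /negPf ->; rewrite mulr1.
have e2 : expR (-1 : R) <= 1 / 2.
  rewrite expRN div1r lef_pV2 ?posrE ?expR_gt0//.
  by apply: le_trans (expR_ge1Dx 1); lra.
have : c * (1 / 2) <= al q * (1 - expR (-1)).
  by apply: ler_pM => //; [exact: ltW|lra].
by lra.
Qed.

(** * A polynomial net of parameters *)

Section Grid.
Variables (R : realType) (Q n : nat) (psi : R -> R) (u v L : R).
Hypothesis n_gt0 : (0 < n)%N.
Hypothesis lipschitz : forall x y, u <= x <= v -> u <= y <= v ->
  `|psi x - psi y| <= L * `|x - y|.
Hypothesis L_ge0 : 0 <= L.
Implicit Types t : param R Q.

Definition grid_point (m k : nat) : R := u + (v - u) * (k%:R / m%:R).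

(** A mesh 1 / n^2 for the connection parameters matches the number of dyads
    and a mesh 1 / n for the proportions the number of nodes: both roundings
    change the likelihood by a bounded factor. *)
Definition grid_index : finType :=
  ({ffun 'I_Q -> 'I_n.+1} * {ffun 'I_Q * 'I_Q -> 'I_(n ^ 2).+1})%type.

Definition grid_param (g : grid_index) : param R Q :=
  (\col_q ((g.1 q)%:R / n%:R),
   \matrix_(q, l) grid_point (n ^ 2) (g.2 (q, l))).

Lemma ceil_ord (m : nat) (s : R) : 0 <= s <= m%:R ->
  exists k : 'I_m.+1, s <= k%:R <= s + 1.
Proof.
move=> /andP[s0 sm]; have ex : exists k, s <= k%:R by exists m.
case: (ex_minnP ex) => k sk kmin; have km : (k < m.+1)%N by rewrite ltnS kmin.
exists (Ordinal km); rewrite /= sk/=.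
case: k sk kmin {km} => [|k] _ kmin; first by rewrite addr_ge0.
rewrite -natr1 lerD2r leNgt; apply/negP => /ltW /kmin.
by rewrite ltnn.
Qed.

(** A linear function on a segment is maximal at an end point, so rounding can
    be made in its favour. *)
Lemma grid_point_favourable (m : nat) (x s : R) : (0 < m)%N -> u <= x <= v ->
  exists k : 'I_m.+1, `|x - grid_point m k| <= (v - u) / m%:R /\
                      x * s <= grid_point m k * s.
Proof.
move=> m0 /andP[ux xv]; have mR : 0 < m%:R :> R by rewrite ltr0n.
have [uv|vu] := eqVneq u v.
  exists ord0; rewrite /grid_point (_ : x = u); last by apply/eqP; rewrite eq_le ux uv xv.
  by rewrite mul0r mulr0 addr0 subrr normr0 uv subrr mul0r lexx.
have {vu}uv : 0 < v - u by rewrite subr_gt0 lt_neqAle vu (le_trans ux xv).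
pose a := (x - u) / (v - u) * m%:R.
have xE : x = u + (v - u) * (a / m%:R).
  by rewrite /a; field; rewrite !gt_eqF.
have a01 : 0 <= a <= m%:R.
  have d0 : 0 <= (x - u) / (v - u) by rewrite divr_ge0 ?subr_ge0// -subr_ge0 ltW.
  rewrite /a mulr_ge0//= ler_piMl// ler_pdivrMr// mul1r lerD2r//.
have key (k : R) : `|a - k| <= 1 ->
    `|x - (u + (v - u) * (k / m%:R))| <= (v - u) / m%:R.
  move=> ak; rewrite {1}xE (_ : _ - _ = (v - u) / m%:R * (a - k)); last first.
    by field; rewrite gt_eqF.
  have d0 : 0 <= (v - u) / m%:R by rewrite divr_ge0// ltW.
  by rewrite normrM ger0_norm// ler_piMr.
have [s0|s0] := leP 0 s.
  have [k /andP[ak ka]] := ceil_ord a01; exists k; split.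
    by apply: key; rewrite distrC ger0_norm ?subr_ge0//; lra.
  rewrite ler_wpM2r// /grid_point [leLHS]xE lerD2l ler_wpM2l//; first exact: ltW.
  by rewrite ler_pM2r ?invr_gt0.
have a01' : 0 <= m%:R - a <= m%:R by move/andP: a01 => [? ?]; apply/andP; split; lra.
have [k /andP[ak ka]] := ceil_ord a01'.
have km : (m - k < m.+1)%N by rewrite ltnS leq_subr.
have kE : (m - k)%:R = m%:R - k%:R :> R by rewrite natrB// -ltnS.
exists (Ordinal km); split; rewrite /grid_point/= kE.
  by apply: key; rewrite ger0_norm ?subr_ge0//; lra.
rewrite ler_wnM2r ?(ltW s0)// [leRHS]xE lerD2l ler_wpM2l ?(ltW uv)//.
by rewrite ler_pM2r ?invr_gt0//; lra.
Qed.

Lemma grid_point_itv (m k : nat) : u <= v -> (k <= m)%N -> (0 < m)%N ->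
  u <= grid_point m k <= v.
Proof.
move=> uv km m0; have mR : 0 < m%:R :> R by rewrite ltr0n.
have : 0 <= (k%:R / m%:R : R) <= 1.
  by rewrite divr_ge0//= ler_pdivrMr// mul1r ler_nat.
move=> /andP[k0 k1]; rewrite /grid_point; apply/andP; split.
  by rewrite lerDl mulr_ge0// subr_ge0.
have : (v - u) * (k%:R / m%:R) <= (v - u) * 1 by rewrite ler_wpM2l// subr_ge0.
by lra.
Qed.

(** The data enter the exponent linearly through the sums of the observed
    values over the pairs of classes, so the rounding direction of each
    connection parameter is the sign of the corresponding sum, whatever the
    size of the data. *)
Lemma amplitude_le_grid (r : rel 'I_n) (y : 'M[R]_n)
    (z : {ffun 'I_n -> 'I_Q}) t : u <= v ->
  (forall q, 0 <= t.1 q ord0 <= 1) -> (forall q l, u <= t.2 q l <= v) ->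
  exists g : grid_index,
    [/\ forall q, t.1 q ord0 <= (grid_param g).1 q ord0
                  <= t.1 q ord0 + n%:R^-1,
        forall q l, `|t.2 q l - (grid_param g).2 q l| <= (v - u) / (n ^ 2)%:R &
        amplitude psi r y z t <=
          expR (L * (v - u) / 2) * amplitude psi r y z (grid_param g)].
Proof.
move=> uv t1 t2; have nR : 0 < n%:R :> R by rewrite ltr0n.
have n2 : (0 < n ^ 2)%N by rewrite expn_gt0 n_gt0.
have n2R : 0 < (n ^ 2)%:R :> R by rewrite ltr0n.
pose E q l := [pred e : 'I_n * 'I_n | ((e.1 != e.2) && r e.1 e.2) &&
                                      ((z e.1, z e.2) == (q, l))].
pose S (p : 'I_Q * 'I_Q) := \sum_(e | E p.1 p.2 e) y e.1 e.2.
have [g1 g1P] : exists g1 : 'I_Q -> 'I_n.+1, forall q,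
    t.1 q ord0 * n%:R <= (g1 q)%:R <= t.1 q ord0 * n%:R + 1.
  apply: (@fin_all_exists _ (fun=> 'I_n.+1) (fun q k =>
    t.1 q ord0 * n%:R <= k%:R <= t.1 q ord0 * n%:R + 1)) => q.
  have /andP[a0 a1] := t1 q.
  by apply: ceil_ord; rewrite mulr_ge0//= ler_piMl.
have [g2 g2P] := @fin_all_exists _ (fun=> 'I_(n ^ 2).+1) _
  (fun p : 'I_Q * 'I_Q => grid_point_favourable (S p) n2 (t2 p.1 p.2)).
pose g : grid_index := (finfun g1, finfun g2).
have a1 q : t.1 q ord0 <= (grid_param g).1 q ord0 <= t.1 q ord0 + n%:R^-1.
  rewrite !mxE ffunE ler_pdivlMr// ler_pdivrMr// mulrDl mulVf ?gt_eqF//.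
have a2 q l : (grid_param g).2 q l = grid_point (n ^ 2) (g2 (q, l)).
  by rewrite mxE ffunE.
exists g; split => //.
  by move=> q l; rewrite a2; have [] := g2P (q, l).
have g2uv q l : u <= (grid_param g).2 q l <= v.
  by rewrite a2; apply: grid_point_itv => //; rewrite -ltnS.
rewrite mulrCA; apply: ler_pM.
- by rewrite prodr_ge0.
- by rewrite prodr_ge0// => e _; exact: expR_ge0.
- apply: ler_prod => i _; rewrite sqrtr_ge0/= ler_wsqrtr//.
  by have /andP[] := a1 (z i).
rewrite -!expR_sum -expRD ler_expR -!mulr_suml -mulrDl ler_wpM2r ?invr_ge0//.
rewrite !sumrB; apply: (@le_trans _ R
  (\sum_(e : 'I_n * 'I_n | (e.1 != e.2) && r e.1 e.2)
     (grid_param g).2 (z e.1) (z e.2) * y e.1 e.2 -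
   \sum_(e : 'I_n * 'I_n | (e.1 != e.2) && r e.1 e.2) psi (t.2 (z e.1) (z e.2)))).
  rewrite lerD2r.
  rewrite !(partition_big (fun e : 'I_n * 'I_n => (z e.1, z e.2)) predT)//=.
  apply: ler_sum => -[q l] _.
  have [_ h] := g2P (q, l); move: h; rewrite -a2 /S !mulr_sumr/= => h.
  rewrite (eq_bigr (fun e => t.2 q l * y e.1 e.2)); last first.
    by move=> e /andP[_ /eqP[-> ->]].
  rewrite [leRHS](eq_bigr (fun e => (grid_param g).2 q l * y e.1 e.2))//.
  by move=> e /andP[_ /eqP[-> ->]].
rewrite addrCA lerD2l -lerBlDr opprK addrC -sumrB.
apply: (@le_trans _ R (\sum_(e : 'I_n * 'I_n | (e.1 != e.2) && r e.1 e.2)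
    L * ((v - u) / (n ^ 2)%:R))).
  apply: ler_sum => e _; apply: le_trans (ler_norm _) _.
  apply: le_trans (lipschitz _ _) _ => //.
  rewrite ler_wpM2l// distrC a2.
  by have [] := g2P (z e.1, z e.2).
apply: (@le_trans _ R (\sum_(e : 'I_n * 'I_n) L * ((v - u) / (n ^ 2)%:R))).
  rewrite [leLHS]big_mkcond/=; apply: ler_sum => e _; case: ifP => // _.
  by rewrite mulr_ge0// divr_ge0// subr_ge0.
rewrite sumr_const card_prod card_ord mulnn -[leLHS]mulr_natr.
by rewrite -(mulrA L) divfK ?gt_eqF.
Qed.

End Grid.

(** * Relabellings and symmetries *)

Section Relabelling.
Variables (R : realType) (Q : nat).
Implicit Types (t : param R Q) (s : 'S_Q) (del : R).

Definition close del t t' : bool :=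
  [forall q, `|t.1 q ord0 - t'.1 q ord0| < del] &&
  [forall q, [forall l, `|t.2 q l - t'.2 q l| < del]].

Lemma closeP del t t' :
  reflect ((forall q, `|t.1 q ord0 - t'.1 q ord0| < del) /\
           (forall q l, `|t.2 q l - t'.2 q l| < del)) (close del t t').
Proof.
apply: (iffP andP) => [[/forallP h1 /forallP h2]|[h1 h2]]; split => //.
- by move=> q l; move/forallP: (h2 q).
- exact/forallP.
- by apply/forallP => q; apply/forallP => l; exact: h2.
Qed.

Lemma close_sym del t t' : close del t t' = close del t' t.
Proof.
by apply/closeP/closeP => -[h1 h2]; split => *; rewrite distrC.
Qed.

Lemma close_trans d1 d2 t t' t'' : close d1 t t' -> close d2 t' t'' ->
  close (d1 + d2) t t''.
Proof.
have tri (x y z : R) : `|x - y| < d1 -> `|y - z| < d2 -> `|x - z| < d1 + d2.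
  move=> xy yz; rewrite (_ : x - z = (x - y) + (y - z)); last by ring.
  by apply: le_lt_trans (ler_normD _ _) _; exact: ltrD.
move=> /closeP[a1 a2] /closeP[b1 b2]; apply/closeP.
by split=> *; exact: tri.
Qed.

Lemma close_relabel s del t t' :
  close del t t' -> close del (relabel s t) (relabel s t').
Proof.
by move=> /closeP[h1 h2]; apply/closeP; split => *; rewrite !mxE.
Qed.

Lemma relabelM s s' t : relabel s (relabel s' t) = relabel (s * s')%g t.
Proof.
rewrite /relabel/=; congr (_, _).
  by apply/matrixP => i j; rewrite !mxE permM.
by apply/matrixP => i j; rewrite !mxE !permM.
Qed.

Lemma relabel1 t : relabel 1 t = t.
Proof.
case: t => a p; rewrite /relabel/=; congr (_, _); apply/matrixP => i j.
  by rewrite !mxE perm1 (ord1 j).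
by rewrite !mxE !perm1.
Qed.

Lemma max_equiv_ge (F : param R Q -> R) t s : F (relabel s t) <= max_equiv F t.
Proof.
rewrite /max_equiv; apply: le_bigmax_seq => //.
by apply/mapP; exists s => //; rewrite mem_enum.
Qed.

Lemma max_equiv_le (F : param R Q -> R) t M :
  (forall s, F (relabel s t) <= M) -> max_equiv F t <= M.
Proof.
move=> FM; rewrite /max_equiv /equiv_params big_map; apply: bigmax_le => //.
by rewrite -(relabel1 t).
Qed.

Lemma card_sym_perms_le t : (#|sym_perms t| <= #|{: 'S_Q}|)%N.
Proof. exact: max_card. Qed.

(** At most one relabelling brings t near a parameter without symmetry, and
    then t has no symmetry either: the sum over relabellings and the maximum
    weighted by the number of symmetries both reduce to that single term. *)
Lemma sum_relabel_approx (F : param R Q -> R) t ts del eta :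
  (forall s, close (2 * del) (relabel s ts) ts -> s = 1%g) -> 0 <= eta ->
  (forall t, 0 <= F t) ->
  (forall s, ~~ close del (relabel s t) ts -> F (relabel s t) <= eta) ->
  `|\sum_(s : 'S_Q) F (relabel s t) - #|sym_perms t|%:R * max_equiv F t| <=
    #|{: 'S_Q}|%:R * eta.
Proof.
move=> sep eta0 F0 far; set K : R := #|{: 'S_Q}|%:R.
have K1 : 1 <= K by rewrite /K ler1n; apply/card_gt0P; exists 1%g.
have max0 : 0 <= max_equiv F t by apply: le_trans (F0 _) (max_equiv_ge F t 1%g).
have [/existsP[s0 s0c]|/existsPn nclose] :=
    boolP [exists s, close del (relabel s t) ts]; last first.
  have S0 : 0 <= \sum_(s : 'S_Q) F (relabel s t) by apply: sumr_ge0.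
  have S1 : \sum_(s : 'S_Q) F (relabel s t) <= K * eta.
    rewrite /K mulr_natl -sumr_const; apply: ler_sum => s _; exact/far/nclose.
  have M1 : max_equiv F t <= eta.
    by apply: max_equiv_le => s; exact/far/nclose.
  have M0 : 0 <= #|sym_perms t|%:R * max_equiv F t by rewrite mulr_ge0.
  have M2 : #|sym_perms t|%:R * max_equiv F t <= K * eta.
    by apply: ler_pM => //; rewrite ler_nat card_sym_perms_le.
  by rewrite ler_norml; apply/andP; split; lra.
have uniq_close s : close del (relabel s t) ts -> s = s0.
  move=> sc; have := close_relabel (s0 * s^-1)%g sc.
  rewrite relabelM mulgKV => s0c'.
  have : close (2 * del) (relabel (s0 * s^-1) ts) ts.
    rewrite mulr2n mulrDl mul1r; apply: close_trans s0c.
    by rewrite close_sym.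
  by move/sep/eqP; rewrite -eq_mulgV1 => /eqP.
have sym1 : #|sym_perms t| = 1%N.
  rewrite (_ : sym_perms t = [set 1%g]%SET) ?cards1//; apply/setP => s; rewrite !inE.
  apply/eqP/eqP => [st|->]; last exact: relabel1.
  have : close del (relabel (s0 * s)%g t) ts by rewrite -relabelM st.
  by move/uniq_close/eqP; rewrite -{2}(mulg1 s0) (inj_eq (mulgI s0)) => /eqP.
rewrite sym1 mul1r (bigD1 s0)//=.
have rest0 : 0 <= \sum_(s | s != s0) F (relabel s t) by apply: sumr_ge0.
have rest1 : \sum_(s | s != s0) F (relabel s t) <= K * eta.
  apply: (@le_trans _ R (\sum_(s : 'S_Q) eta)).
    rewrite [leLHS]big_mkcond/=; apply: ler_sum => s _; case: ifPn => // ss0.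
    by apply: far; apply: contra ss0 => /uniq_close ->.
  by rewrite sumr_const /K [leRHS]mulr_natl lexx.
have M1 : max_equiv F t <= F (relabel s0 t) + eta.
  apply: max_equiv_le => s; have [->|ss0] := eqVneq s s0; first by rewrite lerDl.
  rewrite -[leLHS]add0r; apply: lerD => //.
  by apply: far; apply: contra ss0 => /uniq_close ->.
have M0 := max_equiv_ge F t s0.
have etaK : eta <= K * eta by rewrite ler_peMl.
by rewrite ler_norml; apply/andP; split; lra.
Qed.

Lemma amplitude_relabel (n : nat) (psi : R -> R) (r : rel 'I_n) (y : 'M[R]_n)
    (z0 : {ffun 'I_n -> 'I_Q}) t s :
  amplitude psi r y [ffun i => s (z0 i)] t =
  amplitude psi r y z0 (relabel s t).
Proof.
rewrite /amplitude; congr (_ * _).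
  by apply: eq_bigr => i _; rewrite ffunE mxE.
by apply: eq_bigr => e _; rewrite !ffunE mxE.
Qed.

Lemma big_same_partition (n : nat) (z0 : {ffun 'I_n -> 'I_Q})
    (H : {ffun 'I_n -> 'I_Q} -> R) :
  (forall q, exists i, z0 i = q) ->
  \sum_(z | same_partition z z0) H z =
  \sum_(s : 'S_Q) H [ffun i => s (z0 i)].
Proof.
move=> onto; pose h (s : 'S_Q) := [ffun i => s (z0 i)].
transitivity (\sum_(z in [set h s | s in [set: 'S_Q]]%SET) H z).
  apply: eq_bigl => z; apply/existsP/imsetP => [[s /eqP ->]|[s _ ->]].
    by exists s.
  by exists s.
rewrite big_imset/=; first by apply: eq_bigl => s; rewrite inE.
move=> s s' _ _ /ffunP ss'; apply/permP => q; have [i <-] := onto q.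
by have := ss' i; rewrite !ffunE.
Qed.

End Relabelling.

(** An enlargement of the parameter space that is stable by relabelling. *)
Definition in_box (R : realType) (Q : nat) (u v : R) (t : param R Q) : Prop :=
  [/\ forall q, 0 <= t.1 q ord0 <= 1, \sum_q t.1 q ord0 = 1 &
      forall q l, u <= t.2 q l <= v].

Lemma in_box_relabel (R : realType) (Q : nat) (u v : R) (t : param R Q)
    (s : 'S_Q) : in_box u v t -> in_box u v (relabel s t).
Proof.
move=> [t1 st t2]; split=> [q||q l]; rewrite ?mxE//.
rewrite -st [RHS](reindex_inj (@perm_inj _ s))/=.
by apply: eq_bigr => q _; rewrite mxE.
Qed.

Lemma eq_max_equiv (R : realType) (Q : nat) (F G : param R Q -> R)
    (t : param R Q) :
  (forall s : 'S_Q, F (relabel s t) = G (relabel s t)) ->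
  max_equiv F t = max_equiv G t.
Proof.
move=> FG; have Ft : F t = G t by rewrite -(relabel1 t).
rewrite /max_equiv /equiv_params !big_map Ft.
by apply: eq_bigr => s _; exact: FG.
Qed.

Section Decomposition.
Variables (R : realType) (Q n : nat) (b psi : R -> R) (u v del eta : R).
Variables (r : rel 'I_n) (y : 'M[R]_n) (z0 : {ffun 'I_n -> 'I_Q}).
Variable ts : param R Q.
Hypothesis ts_box : in_box u v ts.
Hypothesis ts_gt0 : forall q, 0 < ts.1 q ord0.
Hypothesis isolated : forall s : 'S_Q,
  close (2 * del) (relabel s ts) ts -> s = 1%g.
Hypotheses (del_gt0 : 0 < del) (eta_ge0 : 0 <= eta).
Hypothesis onto : forall q, exists i, z0 i = q.

Let rr (z : {ffun 'I_n -> 'I_Q}) (t : param R Q) : R :=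
  amplitude psi r y z t / amplitude psi r y z0 ts.

Hypothesis misaligned_small : forall t, in_box u v t ->
  \sum_(z | ~~ same_partition z z0) rr z t ^+ 2 <= eta.
Hypothesis far_small : forall t, in_box u v t -> ~~ close del t ts ->
  rr z0 t ^+ 2 <= eta.
Hypothesis lik_neq0 : complete_lik b psi r y z0 ts != 0.

Let K : R := #|{: 'S_Q}|%:R.

Let close_refl (d : R) (t : param R Q) : 0 < d -> close d t t.
Proof. by move=> d0; apply/closeP; split => *; rewrite subrr normr0. Qed.

Let sym_ts : #|sym_perms ts| = 1%N.
Proof.
rewrite (_ : sym_perms ts = [set 1%g]%SET) ?cards1//; apply/setP => s; rewrite !inE.
apply/eqP/eqP => [st|->]; last exact: relabel1.
by apply: isolated; rewrite st close_refl// mulr_gt0.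
Qed.

Let complete_ratio z t : in_box u v t ->
  complete_lik b psi r y z t / complete_lik b psi r y z0 ts = rr z t ^+ 2.
Proof.
move=> [t1 _ _]; have t0 q : 0 <= t.1 q ord0 by have /andP[] := t1 q.
have ts0 q : 0 <= ts.1 q ord0 by exact: ltW.
move: lik_neq0; rewrite !complete_lik_amplitude//.
rewrite mulf_eq0 negb_or => /andP[B0 _].
by rewrite -mulf_div divff// mul1r expr_div_n.
Qed.

Let total (t : param R Q) : R := \sum_z rr z t ^+ 2.

Let observed_ratio t : in_box u v t ->
  observed_lik b psi r y t / complete_lik b psi r y z0 ts = total t.
Proof.
move=> tb; rewrite /observed_lik mulr_suml.
by apply: eq_bigr => z _; exact: complete_ratio.
Qed.

Let total_split t : in_box u v t ->
  exists2 rest, 0 <= rest <= eta &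
    total t = \sum_(s : 'S_Q) rr z0 (relabel s t) ^+ 2 + rest.
Proof.
move=> tb; exists (\sum_(z | ~~ same_partition z z0) rr z t ^+ 2).
  by rewrite misaligned_small// andbT sumr_ge0// => z _; exact: sqr_ge0.
rewrite /total (bigID (fun z => same_partition z z0))/=; congr (_ + _).
rewrite big_same_partition//; apply: eq_bigr => s _.
by rewrite /rr amplitude_relabel.
Qed.

Let total_ts : 1 <= total ts <= 1 + (K + 1) * eta.
Proof.
have [rest /andP[rest0 rest1] ->] := total_split ts_box.
have rr1 : rr z0 ts = 1 by rewrite /rr divff// gt_eqF// amplitude_gt0.
rewrite (bigD1 1%g)//= relabel1 rr1 expr1n.
have S0 : 0 <= \sum_(s : 'S_Q | s != 1%g) rr z0 (relabel s ts) ^+ 2.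
  by apply: sumr_ge0 => s _; exact: sqr_ge0.
have S1 : \sum_(s : 'S_Q | s != 1%g) rr z0 (relabel s ts) ^+ 2 <= K * eta.
  apply: (@le_trans _ R (\sum_(s : 'S_Q) eta)).
    rewrite [leLHS]big_mkcond/=; apply: ler_sum => s _; case: ifPn => // s1.
    apply: far_small; first exact: in_box_relabel.
    apply: contra s1 => sc; apply/eqP/isolated.
    by rewrite mulr2n mulrDl mul1r; apply: close_trans sc (close_refl _ _).
  by rewrite sumr_const /K [leRHS]mulr_natl lexx.
by rewrite mulrDl mul1r; apply/andP; split; lra.
Qed.

(** The truth is isolated from its relabellings, so the term of the true
    labels, equal to 1, dominates the normalized likelihood of ts. *)
Lemma denominator_error :
  `|(observed_lik b psi r y ts / complete_lik b psi r y z0 ts)^-1 - 1| <=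
    (K + 1) * eta.
Proof.
rewrite observed_ratio//; have /andP[D1 D2] := total_ts.
have D0 : 0 < total ts by apply: lt_le_trans D1.
have Di : (total ts)^-1 <= 1 by rewrite invf_le1.
rewrite distrC ger0_norm ?subr_ge0//.
have -> : 1 - (total ts)^-1 = (total ts - 1) * (total ts)^-1.
  by rewrite mulrBl divff ?gt_eqF// mul1r.
apply: (@le_trans _ R (total ts - 1)); last by lra.
by rewrite ler_piMr// subr_ge0.
Qed.

Lemma numerator_error t : in_box u v t ->
  `|observed_lik b psi r y t / observed_lik b psi r y ts -
    #|sym_perms t|%:R / #|sym_perms ts|%:R *
      max_equiv (fun t' => complete_lik b psi r y z0 t' /
                           complete_lik b psi r y z0 ts) t *
    (observed_lik b psi r y ts / complete_lik b psi r y z0 ts)^-1| <=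
  (K + 1) * eta.
Proof.
move=> tb; have -> : observed_lik b psi r y t / observed_lik b psi r y ts =
    total t / total ts.
  by rewrite -!observed_ratio// invf_div mulrA divfK.
rewrite observed_ratio// sym_ts divr1.
rewrite (@eq_max_equiv _ _ _ (fun t' => rr z0 t' ^+ 2)); last first.
  by move=> s; apply: complete_ratio; exact: in_box_relabel.
rewrite -mulrBl normrM; have /andP[D1 D2] := total_ts.
have D0 : 0 < total ts by apply: lt_le_trans D1.
have Di : `|(total ts)^-1| <= 1 by rewrite gtr0_norm ?invr_gt0// invf_le1.
apply: (@le_trans _ R `|total t - #|sym_perms t|%:R *
                          max_equiv (fun t' => rr z0 t' ^+ 2) t|).
  by rewrite ler_piMr.
have [rest /andP[rest0 rest1] ->] := total_split tb.
rewrite addrAC; apply: le_trans (ler_normD _ _) _; rewrite mulrDl mul1r.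
apply: lerD; last by rewrite ger0_norm.
apply: (@sum_relabel_approx _ _ (fun t' => rr z0 t' ^+ 2) _ ts del) => //.
  by move=> t'; exact: sqr_ge0.
by move=> s; apply: far_small; exact: in_box_relabel.
Qed.

End Decomposition.

(** * The exceptional event and its probability *)

Lemma measure_bigsetU_le (R : realType) (d : measure_display)
    (T : measurableType d) (m : {measure set T -> \bar R}) (I : Type)
    (s : seq I) (F : I -> set T) : (forall i, measurable (F i)) ->
  measurable (\big[setU/set0]_(i <- s) F i) /\
  (m (\big[setU/set0]_(i <- s) F i) <= \sum_(i <- s) m (F i))%E.
Proof.
move=> mF; elim: s => [|i s [mU IH]]; first by rewrite !big_nil measure0.
rewrite !big_cons; split; first exact: measurableU.
by apply: le_trans (measureU2 _ _ _) _ => //; exact: leeD2l.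
Qed.

Lemma markov_on (R : realType) (d : measure_display) (T : measurableType d)
    (m : {measure set T -> \bar R}) (D : set T) (f : T -> R) (x I : R) :
  measurable D -> measurable_fun [set: T] f -> (forall w, 0 <= f w) -> 0 < x ->
  (\int[m]_(w in D) (f w)%:E = I%:E)%E ->
  measurable (D `&` [set w | x < f w]) /\
  (m (D `&` [set w | (x < f w)%R]) <= (I / x)%:E)%E.
Proof.
move=> mD mf f0 x0 intf.
have mE : measurable (D `&` [set w | x < f w]).
  apply: measurableI => //.
  have -> : [set w | x < f w] = f @^-1` `]x, +oo[%classic.
    by apply/seteqP; split => w /=; rewrite in_itv/= andbT.
  by rewrite -[X in measurable X]setTI; exact: mf.
split=> //; rewrite EFinM -intf lee_pdivlMr//.
apply: (@le_trans _ _ (\int[m]_(w in D `&` [set w | (x < f w)%R]) (f w)%:E)%E).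
  rewrite muleC -integral_cst//; apply: ge0_le_integral => //.
  - by move=> w _; rewrite lee_fin ltW.
  - by apply/measurable_EFinP; exact: measurable_funTS.
  - by move=> w [_ /ltW]; rewrite lee_fin.
apply: ge0_subset_integral => //.
- by apply/measurable_EFinP; exact: measurable_funTS.
- by move=> w _; rewrite lee_fin.
Qed.

Section Net.
Variables (R : realType) (Q n : nat) (psi : R -> R) (u v L c eps : R).
Variable ts : param R Q.
Hypotheses (n_gt0 : (0 < n)%N) (uv : u <= v) (L_ge0 : 0 <= L).
Hypothesis lipschitz : forall x y, u <= x <= v -> u <= y <= v ->
  `|psi x - psi y| <= L * `|x - y|.
Hypotheses (ts_box : in_box u v ts) (c_gt0 : 0 < c)
  (ts_ge : forall q, c <= ts.1 q ord0).
Hypotheses (mesh1 : n%:R^-1 <= eps) (mesh2 : (v - u) / (n ^ 2)%:R <= eps).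

Let ts_gt0 q : 0 < ts.1 q ord0. Proof. exact: lt_le_trans (ts_ge q). Qed.

Local Notation grid g := (grid_param u v (g : grid_index Q n)).

(** Rounding up makes the proportions exceed 1 in total by at most Q / n,
    which costs a bounded factor after taking the n-th power. *)
Definition nearly_stochastic (g : grid_index Q n) : bool :=
  \sum_q (grid g).1 q ord0 <= 1 + Q%:R / n%:R.

Lemma grid_param_box (g : grid_index Q n) :
  (forall q, 0 <= (grid g).1 q ord0 <= 1) /\
  (forall q l, u <= (grid g).2 q l <= v).
Proof.
have nR : 0 < n%:R :> R by rewrite ltr0n.
split=> [q|q l]; rewrite mxE.
  by rewrite divr_ge0//= ler_pdivrMr// mul1r ler_nat -ltnS.
apply: grid_point_itv => //; first by rewrite -ltnS ltn_ord.
by rewrite expn_gt0 n_gt0.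
Qed.

(** Everything that has to be negligible, for label vector z0, evaluated on
    the net only. *)
Definition net_remainder (r : rel 'I_n) (y : 'M[R]_n)
    (z0 : {ffun 'I_n -> 'I_Q}) : R :=
  \sum_(g | nearly_stochastic g)
    (\sum_(z | ~~ same_partition z z0)
       amplitude psi r y z (grid g) / amplitude psi r y z0 ts +
     (~~ close eps (grid g) ts)%:R *
       (amplitude psi r y z0 (grid g) / amplitude psi r y z0 ts)).

Let ratio_ge0 (r : rel 'I_n) (y : 'M[R]_n) (z z0 : {ffun 'I_n -> 'I_Q}) t :
  0 <= amplitude psi r y z t / amplitude psi r y z0 ts.
Proof. by rewrite divr_ge0// amplitude_ge0. Qed.

Let net_term_ge0 (r : rel 'I_n) (y : 'M[R]_n) (z0 : {ffun 'I_n -> 'I_Q}) g :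
  0 <= \sum_(z | ~~ same_partition z z0)
         amplitude psi r y z (grid g) / amplitude psi r y z0 ts +
       (~~ close eps (grid g) ts)%:R *
         (amplitude psi r y z0 (grid g) / amplitude psi r y z0 ts).
Proof.
apply: addr_ge0; first by apply: sumr_ge0 => z _; exact: ratio_ge0.
by apply: mulr_ge0; [exact: ler0n|exact: ratio_ge0].
Qed.

Lemma net_remainder_ge0 r y z0 : 0 <= net_remainder r y z0.
Proof. by apply: sumr_ge0 => g _; exact: net_term_ge0. Qed.

Section Domination.
Variables (r : rel 'I_n) (y : 'M[R]_n) (z0 : {ffun 'I_n -> 'I_Q}).

Let rr (z : {ffun 'I_n -> 'I_Q}) (t : param R Q) : R :=
  amplitude psi r y z t / amplitude psi r y z0 ts.

Let rr_ge0 z t : 0 <= rr z t. Proof. exact: ratio_ge0. Qed.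

Let C := expR (L * (v - u) / 2).

Let round z t : in_box u v t -> exists2 g, nearly_stochastic g &
  rr z t <= C * rr z (grid g) /\ (close eps (grid g) ts -> close (2 * eps) t ts).
Proof.
move=> [t1 st t2].
have [g [g1 g2 g3]] := amplitude_le_grid n_gt0 lipschitz L_ge0 r y z uv t1 t2.
exists g.
  apply: (@le_trans _ R (\sum_q (t.1 q ord0 + n%:R^-1))).
    by apply: ler_sum => q _; have /andP[] := g1 q.
  by rewrite big_split/= st sumr_const card_ord -[n%:R^-1 *+ Q]mulr_natl lexx.
split; first by rewrite /rr mulrA ler_wpM2r// invr_ge0 amplitude_ge0.
move=> /closeP[c1 c2]; apply/closeP; split=> [q|q l].
  have h1 : `|t.1 q ord0 - (grid g).1 q ord0| <= eps.
    have /andP[lo hi] := g1 q.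
    by rewrite distrC ger0_norm ?subr_ge0//; move: mesh1; lra.
  rewrite (_ : _ - _ = (t.1 q ord0 - (grid g).1 q ord0) +
    ((grid g).1 q ord0 - ts.1 q ord0)); last by ring.
  by apply: le_lt_trans (ler_normD _ _) _; have := c1 q; lra.
rewrite (_ : _ - _ = (t.2 q l - (grid g).2 q l) +
    ((grid g).2 q l - ts.2 q l)); last by ring.
apply: le_lt_trans (ler_normD _ _) _; have := c2 q l.
by have := le_trans (g2 q l) mesh2; lra.
Qed.

(** A sum of squares of nonnegative terms is at most the square of their sum;
    this undoes the square root taken to integrate. *)
Lemma misaligned_le_net t : in_box u v t ->
  \sum_(z | ~~ same_partition z z0) rr z t ^+ 2 <=
    (C * net_remainder r y z0) ^+ 2.
Proof.
move=> tb; apply: (@le_trans _ R ((\sum_(z | ~~ same_partition z z0) rr z t) ^+ 2)).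
  rewrite [leRHS]expr2 mulr_suml; apply: ler_sum => z zn.
  rewrite expr2 ler_wpM2l// (bigD1 z)//= lerDl.
  by apply: sumr_ge0.
have C0 : 0 <= C by exact: expR_ge0.
have S0 : 0 <= \sum_(z | ~~ same_partition z z0) rr z t by apply: sumr_ge0.
rewrite lerXn2r ?nnegrE ?rr_ge0 ?mulr_ge0 ?net_remainder_ge0//.
rewrite /net_remainder big_split/= mulrDr -[leLHS]addr0 lerD//; last first.
  apply: mulr_ge0 => //; apply: sumr_ge0 => g _.
  by apply: mulr_ge0; [exact: ler0n|exact: ratio_ge0].
rewrite exchange_big/= mulr_sumr; apply: ler_sum => z zn.
have [g gs [rg _]] := round z tb; apply: le_trans rg _.
rewrite ler_wpM2l// [leRHS](bigD1 g)//= lerDl.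
by apply: sumr_ge0 => g' _; exact: ratio_ge0.
Qed.

Lemma far_le_net t : in_box u v t -> ~~ close (2 * eps) t ts ->
  rr z0 t ^+ 2 <= (C * net_remainder r y z0) ^+ 2.
Proof.
move=> tb far; have C0 : 0 <= C by exact: expR_ge0.
rewrite lerXn2r ?nnegrE ?rr_ge0 ?mulr_ge0 ?net_remainder_ge0//.
have [g gs [rg gc]] := round z0 tb; apply: le_trans rg _; rewrite ler_wpM2l//.
rewrite /net_remainder (bigD1 g)//= (_ : close eps _ _ = false); last first.
  by apply/negbTE; apply: contra far.
rewrite mul1r -addrA addrCA lerDl; apply: addr_ge0.
  by apply: sumr_ge0 => z _; exact: ratio_ge0.
by apply: sumr_ge0 => g' _; exact: net_term_ge0.
Qed.

End Domination.

Section Event.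
Variables (d : measure_display) (T : measurableType d) (P : probability T R).
Variables (mu : {measure set (measurableTypeR R) -> \bar R}) (b : R -> R).
Variables (rho : R) (z : T -> {ffun 'I_n -> 'I_Q}) (y : T -> 'M[R]_n)
  (r : T -> rel 'I_n).
Hypothesis sample : sbm_dyad_sample P mu b psi ts rho z y r.
Hypothesis mb : measurable_fun [set: measurableTypeR R] (b : measurableTypeR R -> R).
Hypothesis b_ge0 : forall x, 0 <= b x.
Hypothesis rho01 : 0 <= rho <= 1.
Hypothesis normalized : forall x, u <= x <= v ->
  (\int[mu]_s (phi b psi s x)%:E = 1)%E.

Let ts_itv q l : u <= ts.2 q l <= v. Proof. by case: ts_box. Qed.

Let mid_itv (x a : R) : u <= x <= v -> u <= a <= v -> u <= (x + a) / 2 <= v.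
Proof. by move=> /andP[? ?] /andP[? ?]; apply/andP; split; lra. Qed.

Let mean_ratio (g : grid_index Q n) (z1 z0 : {ffun 'I_n -> 'I_Q}) : R :=
  mean_amplitude_ratio psi rho ts (grid g) z1 z0.

Let integral_ratio (g : grid_index Q n) (z1 z0 : {ffun 'I_n -> 'I_Q}) :
  measurable_fun [set: T] (fun w => amplitude psi (r w) (y w) z1 (grid g) /
                                    amplitude psi (r w) (y w) z0 ts) /\
  (\int[P]_(w in z @^-1` [set z0])
     (amplitude psi (r w) (y w) z1 (grid g) / amplitude psi (r w) (y w) z0 ts)%:E
   = (mean_ratio g z1 z0)%:E)%E.
Proof.
have [_ g2] := grid_param_box g.
apply: (@sbm_integral_amplitude _ _ _ _ _ _ _ _ _ _ (grid g) _ _ _ _ z0 z1 sample) => //.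
- by move=> q l; exact: normalized.
- by move=> q l q' l'; apply: normalized; exact: mid_itv.
Qed.

Let mz0 z0 : measurable (z @^-1` [set z0]).
Proof. by have [[]] := sample. Qed.

Lemma integral_net_remainder z0 :
  measurable_fun [set: T] (fun w => net_remainder (r w) (y w) z0) /\
  (\int[P]_(w in z @^-1` [set z0]) (net_remainder (r w) (y w) z0)%:E =
   (\sum_(g | nearly_stochastic g)
     (\sum_(z1 | ~~ same_partition z1 z0) mean_ratio g z1 z0 +
      (~~ close eps (grid g) ts)%:R * mean_ratio g z0 z0))%:E)%E.
Proof.
have m1 g z1 : measurable_fun [set: T] (fun w =>
    amplitude psi (r w) (y w) z1 (grid g) / amplitude psi (r w) (y w) z0 ts).
  by have [] := integral_ratio g z1 z0.
have m2 g : measurable_fun [set: T] (fun w => \sum_(z1 | ~~ same_partition z1 z0)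
    amplitude psi (r w) (y w) z1 (grid g) / amplitude psi (r w) (y w) z0 ts).
  by under eq_fun do rewrite -big_filter; exact: measurable_sum.
have m3 g : measurable_fun [set: T] (fun w => (~~ close eps (grid g) ts)%:R *
    (amplitude psi (r w) (y w) z0 (grid g) / amplitude psi (r w) (y w) z0 ts)).
  exact: measurable_funM.
have i2 g : (\int[P]_(w in z @^-1` [set z0])
    (\sum_(z1 | ~~ same_partition z1 z0) amplitude psi (r w) (y w) z1 (grid g) /
       amplitude psi (r w) (y w) z0 ts)%:E =
    (\sum_(z1 | ~~ same_partition z1 z0) mean_ratio g z1 z0)%:E)%E.
  under eq_integral do rewrite -big_filter -sumEFin.
  rewrite ge0_integral_sum//.
  - rewrite big_filter -sumEFin; apply: eq_bigr => z1 _.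
    by have [] := integral_ratio g z1 z0.
  - by move=> z1; apply/measurable_EFinP; exact: measurable_funTS.
  - by move=> z1 w _; rewrite lee_fin.
have i3 g : (\int[P]_(w in z @^-1` [set z0])
    ((~~ close eps (grid g) ts)%:R * (amplitude psi (r w) (y w) z0 (grid g) /
       amplitude psi (r w) (y w) z0 ts))%:E =
    ((~~ close eps (grid g) ts)%:R * mean_ratio g z0 z0)%:E)%E.
  under eq_integral do rewrite EFinM.
  rewrite ge0_integralZl//; last 2 first.
  - by apply/measurable_EFinP; exact: measurable_funTS.
  - by move=> w _; rewrite lee_fin.
  by have [_ ->] := integral_ratio g z0 z0.
split.
  rewrite /net_remainder; under eq_fun do rewrite -big_filter.
  by apply: measurable_sum => g; apply: measurable_funD.
rewrite /net_remainder; under eq_integral do rewrite -big_filter -sumEFin.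
rewrite ge0_integral_sum//.
- rewrite big_filter -sumEFin; apply: eq_bigr => g _.
  under eq_integral do rewrite EFinD.
  rewrite ge0_integralD//.
  - by rewrite i2 i3 EFinD.
  - by move=> w _; rewrite lee_fin; apply: sumr_ge0 => z1 _; exact: ratio_ge0.
  - by apply/measurable_EFinP; exact: measurable_funTS.
  - by move=> w _; rewrite lee_fin mulr_ge0 ?ler0n ?ratio_ge0.
  - by apply/measurable_EFinP; exact: measurable_funTS.
- by move=> g; apply/measurable_EFinP; apply: measurable_funTS; apply: measurable_funD.
- by move=> g w _; rewrite lee_fin; exact: net_term_ge0.
Qed.

Definition mean_net_remainder : R :=
  \sum_(z0 | balanced (c / 4) z0) \sum_(g | nearly_stochastic g)
     (\sum_(z1 | ~~ same_partition z1 z0) mean_ratio g z1 z0 +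
      (~~ close eps (grid g) ts)%:R * mean_ratio g z0 z0).

(** Markov's inequality, applied separately on the events z = z0 because the
    remainder is normalized by the amplitude of z0. *)
Lemma net_remainder_event (x : R) : 0 < x -> exists Bad : set T,
  [/\ measurable Bad,
      (P Bad <= (Q%:R * expR (- (c / 4 * n%:R)) + mean_net_remainder / x)%:E)%E &
      forall w, ~ Bad w -> balanced (c / 4) (z w) /\
                           net_remainder (r w) (y w) (z w) <= x].
Proof.
move=> x0; pose F z0 := if balanced (c / 4) z0 then
  z @^-1` [set z0] `&` [set w | x < net_remainder (r w) (y w) z0]
  else z @^-1` [set z0].
have mk z0 := markov_on (mz0 z0) (integral_net_remainder z0).1
  (fun w => net_remainder_ge0 (r w) (y w) z0) x0 (integral_net_remainder z0).2.
have mF z0 : measurable (F z0).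
  by rewrite /F; case: ifP => _; [exact: (mk z0).1|exact: mz0].
have [mU leU] := measure_bigsetU_le P (index_enum {ffun 'I_n -> 'I_Q}) mF.
exists (\big[setU/set0]_z0 F z0); split => //.
  apply: le_trans leU _; rewrite (bigID (fun z0 => balanced (c / 4) z0))/= addeC.
  rewrite EFinD; apply: leeD.
    have [_ sts _] := ts_box.
    apply: (@le_trans _ _ (\sum_(z0 : {ffun 'I_n -> 'I_Q} | ~~ balanced (c / 4) z0)
        \prod_i ts.1 (z0 i) ord0)%:E).
      rewrite -sumEFin; apply: lee_sum => z0 /negPf nb; rewrite /F nb.
      by have [_ -> _ _] := sample.
    by rewrite lee_fin; exact: (@sum_unbalanced_le R Q n (fun q => ts.1 q ord0) c
      ts_ge c_gt0 sts).
  rewrite /mean_net_remainder mulr_suml -sumEFin; apply: lee_sum => z0 bal.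
  by rewrite /F bal; exact: (mk z0).2.
move=> w nB; have nF : ~ F (z w) w.
  by move=> Fw; apply: nB; rewrite (bigD1 (z w))//=; left.
move: nF; rewrite /F; case: ifP => [bal nF|_ []//].
by split=> //; rewrite leNgt; apply/negP => xw; apply: nF.
Qed.

End Event.
End Net.

Lemma card_grid_index_le (Q n : nat) :
  (#|grid_index Q n| <= n.+1 ^ (Q + 2 * Q ^ 2))%N.
Proof.
rewrite card_prod !card_ffun !card_ord card_prod card_ord expnD leq_mul2l.
apply/orP; right; rewrite mulnn.
apply: leq_trans (_ : (n.+1 ^ 2) ^ (Q ^ 2) <= _)%N; last first.
  by rewrite expnM.
case: (posnP Q) => [->|Q0]; first by rewrite !expn0.
rewrite leq_exp2r ?expn_gt0 ?Q0// -!mulnn mulSn mulnS addSn ltnS addnA.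
exact: leq_addl.
Qed.

Section Rate.
Variables (R : realType) (Q n : nat) (psi : R -> R) (u v c h eps rho : R).
Variable ts : param R Q.
Hypotheses (Q_gt0 : (0 < Q)%N) (n_gt0 : (0 < n)%N) (uv : u <= v).
Hypotheses (h_gt0 : 0 < h) (eps_ge0 : 0 <= eps) (c_gt0 : 0 < c).
Hypothesis rho01 : 0 <= rho <= 1.
Hypothesis aff_le1 : forall x a, u <= x <= v -> u <= a <= v ->
  affinity psi x a <= 1.
Hypothesis aff_far : forall x a, u <= x <= v -> u <= a <= v ->
  eps <= `|x - a| -> affinity psi x a <= 1 - h.
Hypothesis ts_box : in_box u v ts.
Hypothesis rows : forall q1 q2, q1 != q2 ->
  exists l, 2 * eps <= `|ts.2 q1 l - ts.2 q2 l|.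
Hypothesis n_large : 2 * Q%:R <= c / 4 * n%:R.

Let lam : R := rho * h * (c / 4 / (2 * Q%:R ^+ 3)) * n%:R.

Lemma mean_net_remainder_le :
  mean_net_remainder n psi u v c eps ts rho <=
  (n.+1 ^ (Q + 2 * Q ^ 2))%:R *
    (#|{ffun 'I_Q -> 'I_Q}|%:R *
      (expR (- (lam / 2)) * expR (Q%:R + n%:R * Q%:R ^+ 2 * expR (- (lam / 2))) +
       (Q%:R ^+ 2 * expR (- (lam * (c / 4)))) ^+ n) +
     expR (Q%:R - n%:R * rho * Num.min (eps ^+ 2 / 8) (h * (c / 4) ^+ 2 / 2))).
Proof.
have gam0 : 0 < c / 4 by rewrite divr_gt0.
set B1 := #|{ffun 'I_Q -> 'I_Q}|%:R * _; set B2 := expR (_ - _).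
have B1_ge0 : 0 <= B1.
  by rewrite mulr_ge0// addr_ge0 ?mulr_ge0 ?exprn_ge0 ?mulr_ge0 ?exprn_ge0 ?expR_ge0.
rewrite /mean_net_remainder exchange_big/=.
apply: (@le_trans _ R (\sum_(g | nearly_stochastic u v (g : grid_index Q n)) (B1 + B2))).
  apply: ler_sum => g gs; rewrite big_split/=.
  have [g1 g2] := grid_param_box n_gt0 uv g; have [ts1 sts ts2] := ts_box.
  apply: lerD.
    apply: (@sum_mean_amplitude_misaligned _ _ _ _ _ h eps) => //.
    - by move=> q l q' l'; exact: aff_le1.
    - by move=> q l q' l'; exact: aff_far.
  rewrite -mulr_sumr; have [cl|far] := boolP (close eps _ ts).
    by rewrite mul0r expR_ge0.
  rewrite mul1r; apply: sum_mean_amplitude_far_param => //.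
  - by move=> q l q' l'; exact: aff_le1.
  - by move=> q l q' l'; exact: aff_far.
  - move: far; rewrite negb_and => /orP[/forallPn[q]|/forallPn[q /forallPn[l]]].
      by rewrite -leNgt => ?; left; exists q.
    by rewrite -leNgt => ?; right; exists q, l.
have B0 : 0 <= B1 + B2 by rewrite addr_ge0// expR_ge0.
apply: (@le_trans _ R (\sum_(g : grid_index Q n) (B1 + B2))).
  by rewrite [leLHS]big_mkcond/=; apply: ler_sum => g _; case: ifP.
rewrite sumr_const -[leLHS]mulr_natl ler_wpM2r// ler_nat.
exact: card_grid_index_le.
Qed.

Let p := (Q + 2 * Q ^ 2)%N.

(** The slowest of the exponential rates, per unit of n * rho. *)
Definition remainder_exponent : R :=
  Num.min (Num.min (h * (c / 4 / (2 * Q%:R ^+ 3)) / 2)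
                   (h * (c / 4 / (2 * Q%:R ^+ 3)) * (c / 4)))
          (Num.min (Num.min (eps ^+ 2 / 8) (h * (c / 4) ^+ 2 / 2)) (c / 4)).

Definition remainder_constant : R :=
  2 ^+ p * (#|{ffun 'I_Q -> 'I_Q}|%:R * (expR (Q%:R + Q%:R ^+ 2) + 1) +
            expR Q%:R).

(* The net has at most (n + 1) ^ p points, one more power of n gives the rate 1 / n, and
   the last one absorbs the Q ^ 2 pairs of classes of each node. *)
Hypothesis log_small : (p.+2)%:R * ln n%:R <= remainder_exponent * (n%:R * rho).
Hypothesis n_ge : (Q ^ 2 <= n)%N.

Let nR : 0 < n%:R :> R. Proof. by rewrite ltr0n. Qed.
Let n1 : 1 <= n%:R :> R. Proof. by rewrite ler1n. Qed.
Let nrho_ge0 : 0 <= n%:R * rho.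
Proof. by have /andP[r0 _] := rho01; rewrite mulr_ge0. Qed.
Let inv_ge0 : 0 <= n%:R^-1 :> R. Proof. by rewrite invr_ge0. Qed.
Let inv_le1 : n%:R^-1 <= 1 :> R. Proof. by rewrite invf_le1. Qed.

Let small_exp a : remainder_exponent <= a ->
  expR (- (a * (n%:R * rho))) <= n%:R^-1 ^+ p.+2.
Proof.
move=> ha; have -> : n%:R^-1 ^+ p.+2 = expR (- (p.+2%:R * ln n%:R)) :> R.
  by rewrite -mulrN expRM_natl expRN lnK ?posrE.
by rewrite ler_expR lerN2; apply: le_trans log_small _; rewrite ler_wpM2r.
Qed.

Let pow_small k : (k <= p.+2)%N -> n%:R^-1 ^+ p.+2 <= n%:R^-1 ^+ k :> R.
Proof. by move=> kp; rewrite ler_wiXn2l. Qed.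

Lemma remainder_bound_rate x : 0 < x ->
  Q%:R * expR (- (c / 4 * n%:R)) + mean_net_remainder n psi u v c eps ts rho / x
  <= (Q%:R + remainder_constant / x) / n%:R.
Proof.
move=> x0; have /andP[rho0 rho1] := rho01.
have exp_le a : remainder_exponent <= a ->
    expR (- (a * (n%:R * rho))) <= n%:R^-1 ^+ p.+1.
  by move=> /small_exp h1; apply: le_trans h1 (pow_small _).
have T0 : expR (- (c / 4 * n%:R)) <= n%:R^-1.
  apply: (@le_trans _ R (expR (- (c / 4 * (n%:R * rho))))).
    rewrite ler_expR lerN2 ler_wpM2l ?divr_ge0 ?(ltW c_gt0)//.
    by rewrite ler_piMr.
  apply: le_trans (small_exp _) _.
    by rewrite /remainder_exponent !ge_min lexx !orbT.
  by rewrite -[leRHS]expr1; exact: pow_small.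
have lamE a : lam * a = h * (c / 4 / (2 * Q%:R ^+ 3)) * a * (n%:R * rho).
  by rewrite /lam; ring.
have T1 : expR (- (lam / 2)) <= n%:R^-1 ^+ p.+1.
  by rewrite lamE; apply: exp_le; rewrite /remainder_exponent !ge_min lexx.
have T2 : expR (- (lam * (c / 4))) <= n%:R^-1 ^+ p.+2.
  by rewrite lamE; apply: small_exp; rewrite /remainder_exponent !ge_min lexx orbT.
have T3 : expR (Q%:R - n%:R * rho * Num.min (eps ^+ 2 / 8) (h * (c / 4) ^+ 2 / 2))
    <= expR Q%:R * n%:R^-1 ^+ p.+1.
  rewrite expRD ler_wpM2l ?expR_ge0// [n%:R * rho * _]mulrC; apply: exp_le.
  by rewrite /remainder_exponent ge_min [X in _ || X]ge_min lexx orbT.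
have T1' : expR (- (lam / 2)) *
    expR (Q%:R + n%:R * Q%:R ^+ 2 * expR (- (lam / 2))) <=
    n%:R^-1 ^+ p.+1 * expR (Q%:R + Q%:R ^+ 2).
  apply: ler_pM; rewrite ?expR_ge0// ler_expR lerD2l mulrAC ler_piMl ?exprn_ge0//.
  apply: (@le_trans _ R (n%:R * n%:R^-1)); last by rewrite divff// gt_eqF.
  rewrite ler_wpM2l//; apply: le_trans T1 _; rewrite exprS.
  by rewrite ler_piMr// exprn_ile1.
have T2' : (Q%:R ^+ 2 * expR (- (lam * (c / 4)))) ^+ n <= n%:R^-1 ^+ p.+1.
  have b0 : 0 <= Q%:R ^+ 2 * expR (- (lam * (c / 4))) :> R.
    by rewrite mulr_ge0 ?exprn_ge0 ?expR_ge0.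
  have b1 : Q%:R ^+ 2 * expR (- (lam * (c / 4))) <= n%:R^-1 ^+ p.+1.
    apply: (@le_trans _ R (n%:R * n%:R^-1 ^+ p.+2)).
      by apply: ler_pM; rewrite ?exprn_ge0 ?expR_ge0// -natrX ler_nat.
    by rewrite exprS mulrA divff ?mul1r// gt_eqF.
  apply: le_trans (ler_iXnr n_gt0 b0 _) (b1); apply: le_trans b1 _.
  by rewrite exprn_ile1.
have main : mean_net_remainder n psi u v c eps ts rho <= remainder_constant / n%:R.
  apply: le_trans mean_net_remainder_le _.
  set S : R := #|{ffun 'I_Q -> 'I_Q}|%:R * (expR (Q%:R + Q%:R ^+ 2) + 1) + expR Q%:R.
  have S0 : 0 <= S by rewrite addr_ge0 ?mulr_ge0 ?addr_ge0 ?expR_ge0.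
  apply: (@le_trans _ R ((2 * n)%:R ^+ p * (S * n%:R^-1 ^+ p.+1))).
    apply: ler_pM => //.
    - rewrite natrX lerXn2r ?nnegrE// ler_nat mul2n -addnn -[n.+1]addn1.
      by rewrite leq_add2l.
    - rewrite /S mulrDl; apply: lerD => //; rewrite -[leRHS]mulrA ler_wpM2l//.
      by rewrite [leRHS]mulrC mulrDr mulr1; apply: lerD.
  rewrite natrM exprMn /remainder_constant -/S.
  have np : n%:R ^+ p * n%:R^-1 ^+ p.+1 = n%:R^-1 :> R.
    by rewrite exprSr mulrA -exprMn divff ?gt_eqF// expr1n mul1r.
  by rewrite -!mulrA (mulrCA _ S) np.
rewrite mulrDl; apply: lerD; first by rewrite ler_wpM2l.
by rewrite mulrAC ler_wpM2r// invr_ge0 ltW.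
Qed.

End Rate.

(** * The expansion *)

Section Error.
Variables (R : realType) (Q n : nat).
Variables (b psi : R -> R) (r : rel 'I_n) (y : 'M[R]_n)
  (z0 : {ffun 'I_n -> 'I_Q}) (ts : param R Q).

Definition denominator_ratio : R :=
  observed_lik b psi r y ts / complete_lik b psi r y z0 ts.

(** Where the complete likelihood of the truth vanishes, so does every
    quotient below, and any value would do. *)
Definition relative_error : R :=
  if complete_lik b psi r y z0 ts == 0 then 0 else denominator_ratio^-1 - 1.

Definition additive_error (t : param R Q) : R :=
  observed_lik b psi r y t / observed_lik b psi r y ts -
  #|sym_perms t|%:R / #|sym_perms ts|%:R *
    max_equiv (fun t' => complete_lik b psi r y z0 t' /
                         complete_lik b psi r y z0 ts) t * (1 + relative_error).

Lemma errors_degenerate (t : param R Q) : complete_lik b psi r y z0 ts = 0 ->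
  (forall q, 0 <= t.1 q ord0) -> (forall q, 0 < ts.1 q ord0) ->
  additive_error t = 0.
Proof.
move=> c0 t0 ts0; have ts0' q : 0 <= ts.1 q ord0 by exact: ltW.
have B0 : base_weight b r y = 0.
  move: c0; rewrite complete_lik_amplitude// => /eqP; rewrite mulf_eq0.
  by rewrite sqrf_eq0 (gt_eqF (amplitude_gt0 _ _ _ _ _))// orbF => /eqP.
rewrite /additive_error /relative_error c0 eqxx addr0 mulr1.
have -> : observed_lik b psi r y t = 0.
  by apply: big1 => z _; rewrite complete_lik_amplitude// B0 mul0r.
rewrite mul0r (@eq_max_equiv _ _ _ (fun=> 0)); last by move=> s; rewrite invr0 mulr0.
suff -> : max_equiv (fun=> 0) t = 0 :> R by rewrite mulr0 subrr.
by apply/eqP; rewrite eq_le max_equiv_le//= (max_equiv_ge (fun=> 0) t 1%g).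
Qed.

End Error.

Lemma error_event (R : realType) (Q n : nat)
    (psi b : R -> R) (u v L c h eps rho x : R) (ts : param R Q)
    (d : measure_display) (T : measurableType d) (P : probability T R)
    (mu : {measure set (measurableTypeR R) -> \bar R})
    (z : T -> {ffun 'I_n -> 'I_Q}) (y : T -> 'M[R]_n) (r : T -> rel 'I_n) :
  (0 < Q)%N -> (0 < n)%N -> u <= v -> 0 <= L ->
  (forall x y, u <= x <= v -> u <= y <= v ->
     `|psi x - psi y| <= L * `|x - y|) ->
  in_box u v ts -> 0 < c -> (forall q, c <= ts.1 q ord0) ->
  n%:R^-1 <= eps -> (v - u) / (n ^ 2)%:R <= eps -> 0 < eps -> 0 < h ->
  sbm_dyad_sample P mu b psi ts rho z y r ->
  measurable_fun [set: measurableTypeR R] (b : measurableTypeR R -> R) ->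
  (forall s, 0 <= b s) -> 0 <= rho <= 1 ->
  (forall x, u <= x <= v -> (\int[mu]_s (phi b psi s x)%:E = 1)%E) ->
  (forall x a, u <= x <= v -> u <= a <= v -> affinity psi x a <= 1) ->
  (forall x a, u <= x <= v -> u <= a <= v -> eps <= `|x - a| ->
     affinity psi x a <= 1 - h) ->
  (forall q1 q2, q1 != q2 ->
     exists l, 2 * eps <= `|ts.2 q1 l - ts.2 q2 l|) ->
  (forall s : 'S_Q, close (2 * (2 * eps)) (relabel s ts) ts -> s = 1%g) ->
  2 * Q%:R <= c / 4 * n%:R ->
  ((Q + 2 * Q ^ 2).+2)%:R * ln n%:R <=
    remainder_exponent Q c h eps * (n%:R * rho) ->
  (Q ^ 2 <= n)%N -> 0 < x ->
  exists Bad : set T,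
  [/\ measurable Bad,
      (P Bad <= ((Q%:R + remainder_constant R Q / x) / n%:R)%:E)%E &
      forall w t, ~ Bad w -> in_box u v t ->
        let e := (#|{: 'S_Q}|%:R + 1) * (expR (L * (v - u) / 2) * x) ^+ 2 in
        `|relative_error b psi (r w) (y w) (z w) ts| <= e /\
        `|additive_error b psi (r w) (y w) (z w) ts t| <= e].
Proof.
move=> Q0 n0 uv L0 lip tsb c0 tsc mesh1 mesh2 eps0 h0 sam mb b0 rho01 norm1 af1.
move=> aff rows isol nbig logs nQ x0.
have [Bad [mBad PBad nBad]] :=
  @net_remainder_event R Q n psi u v c eps ts n0 uv tsb c0 tsc d T P mu b rho
    z y r sam mb b0 rho01 norm1 x x0.
exists Bad; split => //.
  apply: le_trans PBad _; rewrite lee_fin.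
  by apply: (@remainder_bound_rate _ _ _ psi u v c h eps rho ts) => //; exact: ltW.
move=> w t nB tb e; have [bal netx] := nBad w nB.
have ts0 q : 0 < ts.1 q ord0 by exact: lt_le_trans (tsc q).
have e0 : 0 <= e by rewrite mulr_ge0 ?sqr_ge0// addr_ge0.
have [cz|cnz] := eqVneq (complete_lik b psi (r w) (y w) (z w) ts) 0.
  have [t1 _ _] := tb; rewrite errors_degenerate//; last first.
    by move=> q; have /andP[] := t1 q.
  by rewrite /relative_error cz eqxx normr0.
have onto q : exists i, z w i = q.
  have : (0 < #|[set i | z w i == q]%SET|)%N.
    rewrite -(ltr0n R); apply: lt_le_trans (forallP bal q).
    by apply: lt_le_trans nbig; rewrite mulr_gt0 ?ltr0n.
  by move=> /card_gt0P[i]; rewrite inE => /eqP; exists i.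
have C0 : 0 <= expR (L * (v - u) / 2) by exact: expR_ge0.
have small : (expR (L * (v - u) / 2) *
      net_remainder psi u v eps ts (r w) (y w) (z w)) ^+ 2 <=
    (expR (L * (v - u) / 2) * x) ^+ 2.
  by rewrite lerXn2r ?nnegrE ?mulr_ge0 ?net_remainder_ge0 ?(ltW x0)// ler_wpM2l.
have eta0 : 0 <= (expR (L * (v - u) / 2) * x) ^+ 2 by exact: sqr_ge0.
have del0 : 0 < 2 * eps by rewrite mulr_gt0.
have mis t' : in_box u v t' ->
    \sum_(z1 | ~~ same_partition z1 (z w))
      (amplitude psi (r w) (y w) z1 t' / amplitude psi (r w) (y w) (z w) ts) ^+ 2 <=
    (expR (L * (v - u) / 2) * x) ^+ 2.
  move=> tb'; apply: le_trans small.
  exact: (misaligned_le_net ts n0 uv L0 lip mesh1 mesh2).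
have far t' : in_box u v t' -> ~~ close (2 * eps) t' ts ->
    (amplitude psi (r w) (y w) (z w) t' / amplitude psi (r w) (y w) (z w) ts) ^+ 2
    <= (expR (L * (v - u) / 2) * x) ^+ 2.
  move=> tb' nc; apply: le_trans small.
  exact: (far_le_net n0 uv L0 lip mesh1 mesh2 _ _ _ tb' nc).
have D := denominator_error tsb ts0 isol del0 eta0 onto mis far cnz.
have N := numerator_error tsb ts0 isol del0 eta0 onto mis far cnz tb.
rewrite /additive_error /relative_error (negPf cnz); split; first exact: D.
by rewrite subrKC.
Qed.

Lemma finite_positive_threshold (R : realType) (I : finType)
    (G : I -> R -> Prop) :
  (forall i, exists2 e, 0 < e & forall e', 0 < e' <= e -> G i e') ->
  exists2 e : R, 0 < e & forall i, G i e.
Proof.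
move=> H; have [f fP] := choice (fun i => let: ex_intro2 e e0 He := H i in
  ex_intro (fun e => 0 < e /\ forall e', 0 < e' <= e -> G i e') e (conj e0 He)).
exists (\big[Num.min/1]_i f i).
  by apply: lt_bigmin => // i _; have [] := fP i.
move=> i; have [_] := fP i; apply; rewrite bigmin_le_cond// andbT.
by apply: lt_bigmin => // j _; have [] := fP j.
Qed.

(** Distinct mean degrees forbid equal rows in the connection matrix as well as
    nontrivial symmetries; finitely many strict inequalities leave a margin. *)
Lemma separation_radius (R : realType) (Q : nat) (psi : R -> R)
    (ts : param R Q) : distinct_mean_degrees psi ts ->
  exists2 del : R, 0 < del &
    (forall q1 q2, q1 != q2 -> exists l, del <= `|ts.2 q1 l - ts.2 q2 l|) /\
    (forall s : 'S_Q, close (2 * del) (relabel s ts) ts -> s = 1%g).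
Proof.
move=> dist.
have [d1 d10 d1P] : exists2 e : R, 0 < e & forall p : 'I_Q * 'I_Q,
    p.1 != p.2 -> exists l, e <= `|ts.2 p.1 l - ts.2 p.2 l|.
  apply: (@finite_positive_threshold R ('I_Q * 'I_Q)%type (fun p e =>
    p.1 != p.2 -> exists l, e <= `|ts.2 p.1 l - ts.2 p.2 l|)) => -[q1 q2] /=.
  have [->|q12] := eqVneq q1 q2; first by exists 1.
  have [l ql] : exists l, ts.2 q1 l != ts.2 q2 l.
    apply/existsP; apply: contraNT q12 => /existsPn same; apply/eqP/dist.
    rewrite !mxE; apply: eq_bigr => l _; rewrite !mxE.
    by have := same l; rewrite negbK => /eqP ->.
  exists `|ts.2 q1 l - ts.2 q2 l|; first by rewrite normr_gt0 subr_eq0.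
  by move=> e' /andP[_ ?] _; exists l.
have [d2 d20 d2P] : exists2 e : R, 0 < e & forall s : 'S_Q,
    close (2 * e) (relabel s ts) ts -> s = 1%g.
  apply: (@finite_positive_threshold R 'S_Q (fun s e =>
    close (2 * e) (relabel s ts) ts -> s = 1%g)) => s.
  have [->|s1] := eqVneq s 1%g; first by exists 1.
  have move_e (a b : R) : a != b -> exists2 e : R, 0 < e &
      forall e', 0 < e' <= e -> ~ (`|a - b| < 2 * e').
    move=> ab; exists (`|a - b| / 2); first by rewrite divr_gt0// normr_gt0 subr_eq0.
    by move=> e' /andP[_ h1]; apply/negP; rewrite -leNgt; lra.
  have [st|] := eqVneq (relabel s ts) ts.
    exfalso; move/eqP: s1; apply; apply/permP => q; rewrite perm1; apply: dist.
    rewrite !mxE [LHS](reindex_inj (@perm_inj _ s))/=; apply: eq_bigr => l _.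
    have /= := congr1 (fun t : param R Q => t.2 q l) st; rewrite mxE => e2.
    have /= := congr1 (fun t : param R Q => t.1 l ord0) st; rewrite mxE => e1.
    by rewrite !mxE e1 e2.
  move=> st; have [[q q1]|same1] :=
      pselect (exists q, (relabel s ts).1 q ord0 != ts.1 q ord0).
    have [e e0 He] := move_e _ _ q1; exists e => // e' /He ne' /closeP[c1 _].
    by case: ne'; exact: c1.
  have [[q [l q1]]|same2] :=
      pselect (exists q l, (relabel s ts).2 q l != ts.2 q l).
    have [e e0 He] := move_e _ _ q1; exists e => // e' /He ne' /closeP[_ c2].
    by case: ne'; exact: c2.
  exfalso; move/eqP: st; apply.
  rewrite [RHS]surjective_pairing [LHS]surjective_pairing; congr (_, _).
    apply/matrixP => q j; rewrite (ord1 j); apply/eqP; apply: contrapT => /negP ne.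
    by apply: same1; exists q.
  apply/matrixP => q l; apply/eqP; apply: contrapT => /negP ne.
  by apply: same2; exists q, l.
exists (Num.min d1 d2); first by rewrite lt_min d10.
split=> [q1 q2 q12|s].
  have [l ql] := d1P (q1, q2) q12; exists l.
  by apply: le_trans ql; rewrite ge_min lexx.
move=> /closeP[c1 c2]; apply: d2P; apply/closeP.
have m : 2 * Num.min d1 d2 <= 2 * d2 by rewrite ler_wpM2l// ge_min lexx orbT.
by split=> [q|q l]; apply: lt_le_trans m.
Qed.

Lemma mu_ext_cvg0 (R : realType) (d : nat -> measure_display)
    (T : forall n, measurableType (d n)) (P : forall n, probability (T n) R)
    (S : forall n, set (T n)) (C : R) :
  (\forall n \near \oo, exists Bad : set (T n),
    [/\ measurable Bad, (P n Bad <= (C / n%:R)%:E)%E & S n `<=` Bad]) ->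
  (fun n => mu_ext (P n) (S n)) @ \oo --> 0%E.
Proof.
move=> H; apply: (@squeeze_cvge _ _ _ _ (cst 0%E) _ (fun n => (C / n%:R)%:E)).
- apply: filterS H => n [Bad [mBad PBad SBad]]; rewrite mu_ext_ge0//=.
  by apply: le_trans (le_mu_ext _ SBad) _; rewrite measurable_mu_extE.
- exact: (cvg_cst (0 : \bar R)).
- apply: cvg_EFin; first exact: nearW.
  have h0 : C * harmonic n @[n --> \oo] --> C * 0.
    by apply: cvgMl_tmp; exact: cvg_harmonic.
  by rewrite mulr0 in h0; rewrite -(cvg_shiftS (fine \o (fun n : nat => (C / n%:R)%:E))).
Qed.

Theorem theorem4p2 (R : realType) (Q : nat)
    (mu : {measure set (measurableTypeR R) -> \bar R})
    (b psi : R -> R) (A : set R)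
    (Theta : set (param R Q)) (tstar : param R Q) (rho : nat -> R)
    (d : nat -> measure_display) (T : forall n, measurableType (d n))
    (P : forall n, probability (T n) R)
    (z : forall n, T n -> {ffun 'I_n -> 'I_Q})
    (y : forall n, T n -> 'M[R]_n) (r : forall n, T n -> rel 'I_n) :
  (1 <= Q)%N ->
  regular_exp_family mu b psi A ->
  Theta `<=` @param_space R Q A ->
  bounded_params A Theta ->
  rel_interior A Theta tstar ->
  injective_family b psi A ->
  distinct_mean_degrees psi tstar ->
  (forall n, 0 <= rho n <= 1) ->
  (forall n, sbm_dyad_sample (P n) mu b psi tstar (rho n) (z n) (y n) (r n)) ->
  (fun n => n%:R * rho n / ln n%:R) @ \oo --> +oo ->
  exists e1 e2 : forall n, T n -> param R Q -> R,
    [/\ uniform_oP P Theta e1, uniform_oP P Theta e2 &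
      forall n w t, Theta t ->
        observed_lik b psi (r n w) (y n w) t /
          observed_lik b psi (r n w) (y n w) tstar =
        #|sym_perms t|%:R / #|sym_perms tstar|%:R *
          max_equiv (fun t' =>
            complete_lik b psi (r n w) (y n w) (z n w) t' /
            complete_lik b psi (r n w) (y n w) (z n w) tstar) t *
          (1 + e1 n w t) + e2 n w t].
Proof.
move=> Q0 [mb b0 norm1 [smooth _] moments] subTheta [c [c0 [u [v [uvA box]]]]].
move=> [tsTheta _] _ distinct rho01 sample rate.
have inA x : u <= x <= v -> A° x by move=> xuv; apply: uvA; rewrite /= in_itv.
have boxTheta t : Theta t -> in_box u v t.
  move=> Tt; have [t0 st _] := subTheta t Tt; have [tc tuv] := box t Tt.
  by split=> // q; rewrite t0/=; have /andP[_] := tc q; lra.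
have tsb := boxTheta _ tsTheta.
have tsc q : c <= tstar.1 q ord0.
  by have [tc _] := box _ tsTheta; have /andP[] := tc q.
have uv : u <= v.
  have [_ tuv] := box _ tsTheta.
  by have /andP[uq qv] := tuv (Ordinal Q0) (Ordinal Q0); exact: le_trans qv.
have smooth' k x : u <= x <= v -> derivable (derive1n k psi) x 1.
  by move=> /inA; exact: smooth.
have curved x : u <= x <= v -> 0 < derive1n 2 psi x.
  by move=> /inA Ax; have [] := moments x Ax.
have [L L0 lip] := cumulant_lipschitz smooth'.
have [k k0 gap] := cumulant_midpoint_gap smooth' curved.
have [del del0 [rows isol]] := separation_radius distinct.
(* One half of the radius is lost when t is replaced by a point of the net. *)
pose eps := del / 2; have eps0 : 0 < eps by rewrite divr_gt0.
have epsE : 2 * eps = del by rewrite /eps; lra.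
pose h : R := 1 - expR (- (k * eps ^+ 2)).
have h0 : 0 < h by rewrite subr_gt0 expR_lt1 oppr_lt0 mulr_gt0 ?exprn_gt0.
have af1 x a : u <= x <= v -> u <= a <= v -> affinity psi x a <= 1.
  move=> xuv auv; rewrite /affinity expR_le1.
  have := gap x a xuv auv; have : 0 <= k * (x - a) ^+ 2 by rewrite mulr_ge0 ?sqr_ge0 ?ltW.
  by lra.
have aff x a : u <= x <= v -> u <= a <= v -> eps <= `|x - a| ->
    affinity psi x a <= 1 - h.
  move=> xuv auv far; rewrite /affinity /h subKr ler_expR.
  have : k * eps ^+ 2 <= k * (x - a) ^+ 2.
    rewrite ler_wpM2l ?(ltW k0)// -[leRHS]real_normK ?num_real//.
    by rewrite lerXn2r ?nnegrE ?(ltW eps0).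
  by have := gap x a xuv auv; lra.
have norm1' x : u <= x <= v -> (\int[mu]_s (phi b psi s x)%:E = 1)%E.
  by move=> /inA Ax; apply: norm1; exact: (interior_subset Ax).
have rows' q1 q2 : q1 != q2 -> exists l, 2 * eps <= `|tstar.2 q1 l - tstar.2 q2 l|.
  by rewrite epsE; exact: rows.
have isol' (s : 'S_Q) : close (2 * (2 * eps)) (relabel s tstar) tstar -> s = 1%g.
  by rewrite epsE; exact: isol.
pose a0 := remainder_exponent Q c h eps.
have a00 : 0 < a0.
  have c40 : 0 < c / 4 by rewrite divr_gt0.
  have q0 : 0 < c / 4 / (2 * Q%:R ^+ 3).
    by apply: divr_gt0 => //; apply: mulr_gt0 => //; rewrite exprn_gt0// ltr0n.
  rewrite /a0 /remainder_exponent !lt_min c40 andbT.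
  apply/andP; split; apply/andP; split.
  - by apply: divr_gt0 => //; exact: mulr_gt0.
  - by apply: mulr_gt0 => //; exact: mulr_gt0.
  - by apply: divr_gt0 => //; exact: exprn_gt0.
  - by apply: divr_gt0 => //; apply: mulr_gt0 => //; exact: exprn_gt0.
pose p := (Q + 2 * Q ^ 2).+2.
have large : \forall n \near \oo, [/\ (0 < n)%N, n%:R^-1 <= eps,
    (v - u) / (n ^ 2)%:R <= eps, 2 * Q%:R <= c / 4 * n%:R &
    p%:R * ln n%:R <= a0 * (n%:R * rho n) /\ (Q ^ 2 <= n)%N].
  have near_ge (a : R) : \forall n \near \oo, a <= n%:R.
    near=> n; apply: ltW; near: n; exact: nbhs_infty_gtr.
  have near_rate : \forall n \near \oo, p%:R / a0 <= n%:R * rho n / ln n%:R.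
    by move/cvgryPge: rate; apply.
  near=> n; have n2 : 1 < n%:R :> R by near: n; exact: nbhs_infty_gtr.
  have n1 : 0 < n%:R :> R by lra.
  have n0 : (0 < n)%N by rewrite -(ltr0n R).
  split=> //.
  - rewrite invf_ple ?posrE//; near: n; exact: near_ge.
  - rewrite ler_pdivrMr ?ltr0n ?expn_gt0 ?n0// natrX -ler_pdivrMl//.
    apply: (@le_trans _ R n%:R); first by near: n; exact: near_ge.
    by rewrite expr2 ler_peMl// ltW.
  - rewrite -ler_pdivrMl ?divr_gt0//; near: n; exact: near_ge.
  - split; last by near: n; exact: nbhs_infty_ge.
    have lnn : 0 < ln n%:R :> R by exact: ln_gt0.
    rewrite -ler_pdivrMl// mulrA [a0^-1 * _]mulrC -ler_pdivlMr//.
    near: n; exact: near_rate.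
pose e1 n w (t : param R Q) :=
  relative_error b psi (r n w) (y n w) (z n w) tstar.
pose e2 n w t := additive_error b psi (r n w) (y n w) (z n w) tstar t.
have small (eps1 : R) : 0 < eps1 -> exists C : R, \forall n \near \oo,
    exists Bad : set (T n), [/\ measurable Bad, (P n Bad <= (C / n%:R)%:E)%E &
      forall w t, ~ Bad w -> Theta t -> `|e1 n w t| <= eps1 /\ `|e2 n w t| <= eps1].
  move=> eps10.
  pose K : R := (#|{: 'S_Q}|%:R + 1) * expR (L * (v - u) / 2) ^+ 2.
  have K0 : 0 < K by rewrite mulr_gt0 ?exprn_gt0 ?expR_gt0// ltr_wpDl.
  (* Capping x at 1 gives x ^ 2 <= x. *)
  pose x := Num.min 1 (eps1 / K).
  have x0 : 0 < x by rewrite lt_min ltr01 divr_gt0.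
  have xK : (#|{: 'S_Q}|%:R + 1) * (expR (L * (v - u) / 2) * x) ^+ 2 <= eps1.
    rewrite exprMn mulrA -/K mulrC -ler_pdivlMr//.
    apply: (@le_trans _ R x); last by rewrite /x ge_min lexx orbT.
    by rewrite expr2 ler_piMl ?(ltW x0)// /x ge_min lexx.
  exists (Q%:R + remainder_constant R Q / x); near=> n.
  have [n0 mesh1 mesh2 nbig [logs nQ]] : [/\ (0 < n)%N, n%:R^-1 <= eps,
    (v - u) / (n ^ 2)%:R <= eps, 2 * Q%:R <= c / 4 * n%:R &
    p%:R * ln n%:R <= a0 * (n%:R * rho n) /\ (Q ^ 2 <= n)%N].
    by near: n; exact: large.
  have [Bad [mBad PBad nBad]] := @error_event R Q n psi b u v L c h eps (rho n) x
    tstar _ (T n) (P n) mu (z n) (y n) (r n) Q0 n0 uv L0 lip tsb c0 tsc mesh1 mesh2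
    eps0 h0 (sample n) mb b0 (rho01 n) norm1' af1 aff rows' isol' nbig logs nQ x0.
  exists Bad; split => // w t nB Tt.
  by have [E1 E2] := nBad w t nB (boxTheta t Tt); split; exact: le_trans xK.
have oP (e : forall n, T n -> param R Q -> R) :
    (forall eps1 : R, 0 < eps1 -> exists C : R, \forall n \near \oo,
      exists Bad : set (T n), [/\ measurable Bad, (P n Bad <= (C / n%:R)%:E)%E &
        forall w t, ~ Bad w -> Theta t -> `|e n w t| <= eps1]) ->
    uniform_oP P Theta e.
  move=> H eps1 /H[C nearC]; apply: (@mu_ext_cvg0 _ _ _ _ _ C).
  apply: filterS nearC => n [Bad [mBad PBad nBad]]; exists Bad; split => // w /=.
  apply: contraPP => nB; apply/negP; rewrite -leNgt; apply: ge_ereal_sup.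
  by move=> _ [t Tt <-]; rewrite lee_fin; exact: nBad.
exists e1, e2; split.
- apply: oP => eps1 /small[C nearC]; exists C.
  apply: filterS nearC => n [Bad [mBad PBad nBad]]; exists Bad; split => // w t nB Tt.
  by have [] := nBad w t nB Tt.
- apply: oP => eps1 /small[C nearC]; exists C.
  apply: filterS nearC => n [Bad [mBad PBad nBad]]; exists Bad; split => // w t nB Tt.
  by have [] := nBad w t nB Tt.
- by move=> n w t Tt; rewrite /e2 /additive_error /e1 addrC subrK.
Unshelve. all: by end_near. Qed.
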